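(* For every $\varepsilon>0$ there is a constant $C_\varepsilon$ such that the following holds. Let $A=\{a_1,\ldots,a_n\}$ and $B=\{b_1,\ldots,b_n\}$ be multisets of $n$ real numbers such that $M(A)M(B)\ge n^{3+\varepsilon}$. If $\pi$ is a uniformly random permutation of $\{1,\ldots,n\}$, then \[Q\Big[\sum_{i=1}^n a_i b_{\pi(i)}\Big]\le C_\varepsilon\,\frac{n^{1/2}(\log n)^2}{\sqrt{M(A)M(B)}}.\]
   Context: For a random variable $X$, $Q[X]=\sup_x \mathbb{P}[X=x]$. For a multiset $B$ of $n$ reals, its multiplicity profile $\mu(B)=(\mu_1,\ldots,\mu_\ell)$ is the partition of $n$ such that the $\ell$ distinct elements of $B$ occur with multiplicities $\mu_1\ge\cdots\ge\mu_\ell$, and $M(B)=\sum_{i=1}^{\ell}(i-1)^2\mu_i$; $M(A)$ is defined in the same way. *)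

(* Defs.v *)
From HB Require Import structures.
From mathcomp Require Import all_boot all_order all_algebra all_fingroup.
From mathcomp Require Import all_classical all_reals all_analysis.
Set Implicit Arguments. Unset Strict Implicit. Unset Printing Implicit Defensive.
Import Order.TTheory GRing.Theory Num.Theory.
Local Open Scope ring_scope.

Definition mult_profile (T : eqType) (s : seq T) : seq nat :=
  sort geq [seq count_mem x s | x <- undup s].

(* M(B) = sum_{i=1}^{l} (i-1)^2 mu_i  (here indices are 0-based, so i^2). *)
Definition Mprof (T : eqType) (s : seq T) : nat :=
  let mu := mult_profile s in
  (\sum_(i < size mu) i ^ 2 * nth 0 mu i)%N.

Definition msetOf (T : eqType) n (a : 'I_n -> T) : seq T := [seq a i | i <- enum 'I_n].

Definition permsum (R : realType) n (a b : 'I_n -> R) (p : 'S_n) : R :=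
  \sum_(i < n) a i * b (p i).

Definition probeq (R : realType) n (a b : 'I_n -> R) (x : R) : R :=
  #|[set p : 'S_n | permsum a b p == x]|%:R / (n`!)%:R.

(* Q[X] = sup_x P[X = x]; X takes finitely many values, and values not taken
   have probability 0, so the sup is the max over the values X(sigma). *)
Definition Qconc (R : realType) n (a b : 'I_n -> R) : R :=
  \big[Num.max/0]_(s : 'S_n) probeq a b (permsum a b s).

(* Main.v *)
(* Write [X = \sum_i a_i b_(pi i)], and call [walk s] the law of
   [\sum_i (xi_i - xi'_i) s_i] for independent fair bits [xi_i, xi'_i]. It is a
   positive definite function [f] of total mass 1, so [f 0 - f x] behaves like a
   squared distance: if it is small on a set of shifts, it stays small on sums of
   these shifts, and the total mass then bounds [f 0] by the inverse size of the
   sumset.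

   - Composing [pi] with random swaps of disjoint pairs [(i, j)] turns [X] into a
     random signed sum with increments [(a_i - a_j) (b_(pi i) - b_(pi j))].
   - [A] contains [k] values with at least [S] copies each, where
     [k^3 S >= M(A) / (1 + ln n)] (harmonic sum over the profile); similarly [l]
     and [T] for [B]. Restrict the swaps to such elements.
   - For a block of about [ln n] random increments, [E (walk 0) = O(1 / (k l))]:
     as long as [walk 0] is larger, each new increment lowers it by a constant
     factor, since otherwise it would be nearly invariant under most products
     [(a - al) (b - be)], and these have at least [c k l] distinct short sums.
   - Adding [G] independent blocks gains a further factor [sqrt G], by a
     Nash-type argument resting on [|X + X| >= 2 |X| - 1].
   - [G] is of order [k S l T / (n (ln n)^2)]: a swap is useful only if it meets
     the chosen elements of [B], and each useful swap is looked for in a list long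
     enough for the failure probability to be negligible. *)

Require Import Defs.
From HB Require Import structures.
From mathcomp Require Import all_boot all_order all_algebra all_fingroup.
From mathcomp Require Import all_classical all_reals all_analysis.
From mathcomp Require Import ring lra zify.
Import Order.TTheory GRing.Theory Num.Theory.
Local Open Scope ring_scope.

(** * Autocorrelations and signed random sums *)

Section Autocorrelation.
Set Implicit Arguments.
Unset Strict Implicit.
Variable R : realType.
Implicit Types (s t : seq R) (f g : R -> R).

(** The list holds pairs (coefficient, point). Points may repeat, so families of translates can be
    tested without collecting terms. *)
Definition posdef f := forall s : seq (R * R),
  0 <= \sum_(p <- s) \sum_(q <- s) p.1 * q.1 * f (p.2 - q.2).

(** The properties used of the law of a difference [Y - Y'] of independent copies; they survive
    averaging over laws. The mass is bounded on finite duplicate-free lists, which avoids infinite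
    sums. *)
Record acf f : Prop := Acf {
  acf_pd : posdef f;
  acf_ge0 : forall x, 0 <= f x;
  acf_even : forall x, f (- x) = f x;
  acf_mass : forall s, uniq s -> \sum_(x <- s) f x <= 1 }.

Definition delta0 (x : R) : R := (x == 0)%:R.

(** If [f] is the law of [Z], this is the law of [Z + y - y'] for independent uniform entries [y],
    [y'] of [t], counted with multiplicity. *)
Definition autocorr t f (x : R) : R :=
  (\sum_(y <- t) \sum_(z <- t) f (x + y - z)) / (size t)%:R ^+ 2.

Lemma sum_eq_uniq (T : eqType) (r : seq T) (x : T) : uniq r ->
  \sum_(v <- r) (v == x)%:R = (x \in r)%:R :> R.
Proof.
move=> ur; rewrite -(count_uniq_mem x ur) -sum1_count natr_sum [RHS]big_mkcond /=.
by apply: eq_bigr => v _; case: (v == x).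
Qed.

Lemma acf_delta0 : acf delta0.
Proof.
split.
- move=> s; set u := undup [seq p.2 | p <- s].
  (* Grouping the points by their value turns the form into a sum of squares. *)
  suff -> : \sum_(p <- s) \sum_(q <- s) p.1 * q.1 * delta0 (p.2 - q.2)
     = \sum_(v <- u) (\sum_(p <- s) p.1 * (v == p.2)%:R) ^+ 2.
    by apply: sumr_ge0 => v _; exact: sqr_ge0.
  transitivity (\sum_(v <- u) \sum_(p <- s) \sum_(q <- s)
     p.1 * q.1 * ((v == p.2)%:R * (v == q.2)%:R)).
    rewrite [RHS]exchange_big /=; apply: eq_big_seq => p ps.
    rewrite [RHS]exchange_big /=; apply: eq_bigr => q _.
    rewrite -mulr_sumr; congr (_ * _).
    have -> : delta0 (p.2 - q.2) = \sum_(v <- u) (v == p.2)%:R * (p.2 == q.2)%:R.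
      rewrite -mulr_suml sum_eq_uniq ?undup_uniq // mem_undup map_f // mul1r.
      by rewrite /delta0 subr_eq0.
    by apply: eq_bigr => v _; case: (v =P p.2) => [->|]; rewrite ?mul0r.
  apply: eq_bigr => v _; rewrite expr2 mulr_suml; apply: eq_bigr => p _.
  by rewrite mulr_sumr; apply: eq_bigr => q _; ring.
- by move=> x; exact: ler0n.
- by move=> x; rewrite /delta0 oppr_eq0.
- by move=> s us; rewrite /delta0 sum_eq_uniq // lern1 leq_b1.
Qed.

Lemma size_sqr_gt0 t : t != [::] -> 0 < (size t)%:R ^+ 2 :> R.
Proof. by case: t => // x t _; rewrite exprn_gt0 // ltr0n. Qed.

Lemma acf_autocorr t f : t != [::] -> acf f -> acf (autocorr t f).
Proof.
move=> t0 [pd f0 ev ms]; have N0 := size_sqr_gt0 t0.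
split.
(* Up to scaling, the form of [autocorr t f] on [s] is the form of [f] on all translates of the
   points by entries of [t]. *)
- move=> s; have := pd [seq (p.1, p.2 + y) | p <- s, y <- t].
  rewrite big_allpairs_dep /=.
  under eq_bigr => p _ do under eq_bigr => y _ do rewrite big_allpairs_dep /=.
  move=> H.
  suff -> : \sum_(p <- s) \sum_(q <- s) p.1 * q.1 * autocorr t f (p.2 - q.2) =
    (\sum_(p <- s) \sum_(y <- t) \sum_(q <- s) \sum_(z <- t)
        p.1 * q.1 * f (p.2 + y - (q.2 + z))) / (size t)%:R ^+ 2.
    by apply: divr_ge0 => //; exact: ltW.
  rewrite mulr_suml; apply: eq_bigr => p _.
  rewrite exchange_big /= mulr_suml; apply: eq_bigr => q _.
  rewrite /autocorr mulrA mulr_sumr; congr (_ / _); apply: eq_bigr => y _.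
  by rewrite mulr_sumr; apply: eq_bigr => z _; congr (_ * f _); ring.
- move=> x; apply: divr_ge0; last exact: ltW.
  by apply: sumr_ge0 => y _; apply: sumr_ge0.
- move=> x; rewrite /autocorr exchange_big /=; congr (_ / _).
  apply: eq_bigr => y _; apply: eq_bigr => z _; rewrite -ev; congr (f _); ring.
- move=> s us; rewrite /autocorr -mulr_suml ler_pdivrMr // mul1r.
  rewrite exchange_big /=.
  under eq_bigr => y _ do rewrite exchange_big /=.
  have -> : (size t)%:R ^+ 2 = \sum_(y <- t) \sum_(z <- t) (1 : R).
    by rewrite !big_const_seq !count_predT !iter_addr_0 expr2 mulr_natr.
  apply: ler_sum => y _; apply: ler_sum => z _.
  have /ms : uniq [seq x + (y - z) | x <- s] by rewrite map_inj_uniq //; exact: addIr.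
  by rewrite big_map; under eq_bigr => x _ do rewrite addrA.
Qed.

Lemma acf_avg (I : finType) (w : I -> R) (F : I -> R -> R) :
  (forall i, 0 <= w i) -> \sum_i w i = 1 -> (forall i, acf (F i)) ->
  acf (fun x => \sum_i w i * F i x).
Proof.
move=> w0 w1 aF; split.
- move=> s.
  have -> : \sum_(p <- s) \sum_(q <- s) p.1 * q.1 * (\sum_i w i * F i (p.2 - q.2))
    = \sum_i w i * \sum_(p <- s) \sum_(q <- s) p.1 * q.1 * F i (p.2 - q.2).
    under [RHS]eq_bigr => i _ do rewrite mulr_sumr.
    rewrite [RHS]exchange_big; apply: eq_bigr => p _ /=.
    under [RHS]eq_bigr => i _ do rewrite mulr_sumr.
    rewrite [RHS]exchange_big; apply: eq_bigr => q _ /=.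
    rewrite mulr_sumr; apply: eq_bigr => i _; ring.
  by apply: sumr_ge0 => i _; apply: mulr_ge0 => //; apply: acf_pd.
- by move=> x; apply: sumr_ge0 => i _; apply: mulr_ge0 => //; apply: acf_ge0.
- by move=> x; apply: eq_bigr => i _; rewrite acf_even.
- move=> s us; rewrite exchange_big /= -w1; apply: ler_sum => i _.
  by rewrite -mulr_sumr ler_piMr // acf_mass.
Qed.

(** Positive definiteness with coefficients 1, -1 at [0] and [x]. *)
Lemma acf_le0 f : acf f -> forall x, f x <= f 0.
Proof.
move=> af x; have := acf_pd af [:: (1, 0); (-1, x)].
rewrite !big_cons !big_nil /= !subrr !sub0r !subr0 (acf_even af).
lra.
Qed.

(** Positive definiteness with coefficients 1, -2, 1 at [0], [x], [x + y]: this is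
    [|u + v|^2 <= 2 |u|^2 + 2 |v|^2] for the squared distance [f 0 - f x]. *)
Lemma acf_triangle f : acf f ->
  forall x y, f 0 - f (x + y) <= 2 * (f 0 - f x) + 2 * (f 0 - f y).
Proof.
move=> af x y; have := acf_pd af [:: (1, 0); (-2, x); (1, x + y)].
rewrite !big_cons !big_nil /= !subrr !sub0r !subr0 !(acf_even af).
rewrite [x + y - x]addrAC subrr add0r.
have -> : x - (x + y) = - y by ring.
rewrite (acf_even af); lra.
Qed.

Lemma acf_0_le1 f : acf f -> f 0 <= 1.
Proof. by move=> af; have := @acf_mass _ af [:: 0] isT; rewrite big_seq1. Qed.

Lemma eq_autocorr t f g : f =1 g -> autocorr t f =1 autocorr t g.
Proof.
move=> fg x; congr (_ / _); apply: eq_bigr => y _; apply: eq_bigr => z _; exact: fg.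
Qed.

Definition sadd s t := [seq x + y | x <- s, y <- t].

Lemma autocorr_sadd s t f x :
  autocorr (sadd s t) f x = autocorr s (autocorr t f) x.
Proof.
rewrite /autocorr size_allpairs natrM exprMn invfM mulrA [_ / _ / _]mulrAC.
congr (_ / _); rewrite big_allpairs_dep /= mulr_suml; apply: eq_bigr => y _.
under eq_bigr => y' _ do rewrite big_allpairs_dep /=.
rewrite exchange_big /= mulr_suml; apply: eq_bigr => z _; congr (_ / _).
apply: eq_bigr => y' _; apply: eq_bigr => z' _; congr (f _); ring.
Qed.

Lemma autocorrC s t f x :
  autocorr s (autocorr t f) x = autocorr t (autocorr s f) x.
Proof.
rewrite -!autocorr_sadd /autocorr !size_allpairs mulnC; congr (_ / _).
rewrite !big_allpairs_dep /= exchange_big /=; apply: eq_bigr => y _; apply: eq_bigr => y' _.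
rewrite !big_allpairs_dep exchange_big /=; apply: eq_bigr => z _; apply: eq_bigr => z' _.
by congr (f _); rewrite [y + y']addrC [z + z']addrC.
Qed.

Lemma autocorr_0_le t f : t != [::] -> acf f -> autocorr t f 0 <= f 0.
Proof.
move=> t0 af; rewrite ler_pdivrMr ?size_sqr_gt0 //.
have -> : f 0 * (size t)%:R ^+ 2 = \sum_(y <- t) \sum_(z <- t) f 0.
  by rewrite !big_const_seq !count_predT !iter_addr_0 expr2 mulrA !mulr_natr.
by apply: ler_sum => y _; apply: ler_sum => z _; apply: acf_le0.
Qed.

(** All [2^(size s)] subset sums with repetition, so that a uniform entry is the sum with
    independent fair bits. *)
Fixpoint subsums s : seq R :=
  if s is c :: s' then sadd [:: 0; c] (subsums s') else [:: 0].

Lemma subsums_neq0 s : subsums s != [::].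
Proof. by elim: s => //= c s; case: (subsums s). Qed.

Lemma sadd0l t : sadd [:: 0] t = t.
Proof. by rewrite /sadd /= cats0; under eq_map => x do rewrite add0r; rewrite map_id. Qed.

Lemma sadd_cons x s t : sadd (x :: s) t = [seq x + y | y <- t] ++ sadd s t.
Proof. by []. Qed.

Lemma sadd_cat s1 s2 t : sadd (s1 ++ s2) t = sadd s1 t ++ sadd s2 t.
Proof. exact: allpairs_cat. Qed.

Lemma saddA s t u : sadd s (sadd t u) = sadd (sadd s t) u.
Proof.
elim: s => [|x s IH]; first by [].
rewrite !sadd_cons sadd_cat -IH; congr (_ ++ _).
elim: t {IH} => [|y t IH]; first by [].
rewrite [sadd (y :: t) u]sadd_cons map_cat IH map_cons sadd_cons; congr (_ ++ _).
by rewrite -map_comp; apply: eq_map => z /=; rewrite addrA.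
Qed.

Lemma subsums_cat s t : subsums (s ++ t) = sadd (subsums s) (subsums t).
Proof. by elim: s => [|c s IH]; [rewrite sadd0l | rewrite [LHS]/= IH saddA]. Qed.

(* [walk s x] is the probability that the signed combination of the entries of
   [s] with independent coefficients [xi - xi'] ([xi], [xi'] fair bits) is [x]. *)
Definition walk s := autocorr (subsums s) delta0.

Lemma acf_walk s : acf (walk s).
Proof. exact: (acf_autocorr (subsums_neq0 s) acf_delta0). Qed.

Lemma walk_cat s t x : walk (s ++ t) x = autocorr (subsums s) (walk t) x.
Proof. by rewrite /walk subsums_cat autocorr_sadd. Qed.

Lemma autocorr_pair c f x :
  autocorr [:: 0; c] f x = (2 * f x + f (x + c) + f (x - c)) / 4.
Proof.
rewrite /autocorr !big_cons !big_nil /= !addr0 !subr0 addrK.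
have -> : 2%:R ^+ 2 = 4 :> R by rewrite -natrX.
by congr (_ / _); ring.
Qed.

Lemma walk_cons c s x : walk (c :: s) x = autocorr [:: 0; c] (walk s) x.
Proof. by rewrite /walk -autocorr_sadd. Qed.

Lemma walk_nil : walk [::] =1 delta0.
Proof.
move=> x; rewrite /walk /autocorr /= !big_cons !big_nil !addr0 subr0.
by rewrite expr1n divr1.
Qed.

Lemma walk_catCA s t u x : walk (s ++ t ++ u) x = walk (t ++ s ++ u) x.
Proof.
rewrite !walk_cat; under eq_autocorr => y do rewrite walk_cat.
by rewrite autocorrC; apply: eq_autocorr => y; rewrite walk_cat.
Qed.

(** Every further increment [c] applies [autocorr [:: 0; c]], which cannot raise the value at 0. *)
Lemma walk_subseq s t : subseq s t -> walk t 0 <= walk s 0.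
Proof.
(* The prefix [u] collects matched entries; a dropped entry is moved to the front by
   [walk_catCA]. *)
suff H u : subseq s t -> walk (u ++ t) 0 <= walk (u ++ s) 0 by move/(H [::]).
elim: t s u => [|y t IH] s u; first by rewrite subseq0 => /eqP ->.
case: s => [|x s] /=.
  move=> _; rewrite (walk_catCA u [:: y]) /= walk_cons.
  apply: le_trans (IH [::] u _); last exact: sub0seq.
  by apply: autocorr_0_le => //; exact: acf_walk.
case: eqP => [->|_] st.
  by rewrite -[y :: t]cat1s -[y :: s]cat1s !catA; apply: IH.
rewrite (walk_catCA u [:: y]) /= walk_cons.
apply: le_trans (IH _ u st).
by apply: autocorr_0_le => //; exact: acf_walk.
Qed.

(** The increment [c] alone leaves mass one half at 0, and the others cannot raise it. *)
Lemma walk_0_le_half s c : c \in s -> c != 0 -> walk s 0 <= 2^-1.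
Proof.
move=> cs c0; have : subseq [:: c] s by rewrite sub1seq.
move/walk_subseq/le_trans; apply.
rewrite walk_cons autocorr_pair !walk_nil /delta0 add0r sub0r oppr_eq0 eqxx (negPf c0).
by rewrite /=; lra.
Qed.

Lemma walk_0_le1 s : walk s 0 <= 1.
Proof. exact: acf_0_le1 (acf_walk s). Qed.

Lemma walk_0_ge0 s : 0 <= walk s 0.
Proof. exact: acf_ge0 (acf_walk s) 0. Qed.

(* Positive definiteness of [delta0] is the inequality
   [2 <f, g> <= |f|^2 + |g|^2] for the laws [f], [g] of the two half sums. *)
Lemma subsums_cat_conc s t x :
  (count_mem x (subsums (s ++ t)))%:R / (size (subsums (s ++ t)))%:R
   <= 2^-1 * (walk s 0 + walk t 0).
Proof.
rewrite subsums_cat; set A := subsums s; set B := subsums t.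
set a : R := (size A)%:R; set b : R := (size B)%:R.
have a0 : a != 0 by rewrite pnatr_eq0 size_eq0 subsums_neq0.
have b0 : b != 0 by rewrite pnatr_eq0 size_eq0 subsums_neq0.
(* Reflecting the second half sum at [x] turns the event that both half sums add up to [x] into a
   coincidence of two points. *)
have := acf_pd acf_delta0 ([seq (a^-1, y) | y <- A] ++ [seq (- b^-1, x - y) | y <- B]).
rewrite big_cat !big_map /=.
under eq_bigr => y _ do rewrite big_cat !big_map /=.
under [X in _ + X]eq_bigr => y _ do rewrite big_cat !big_map /=.
rewrite !big_split /=.
set S := (count_mem x (sadd A B))%:R.
have Sab : S = \sum_(y <- A) \sum_(z <- B) delta0 (y - (x - z)).
  rewrite /S -sum1_count natr_sum big_mkcond big_allpairs_dep /=.
  apply: eq_bigr => y _; apply: eq_bigr => z _.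
  have -> : y - (x - z) = y + z - x by ring.
  by rewrite /delta0 subr_eq0; case: eqP.
have Sba : S = \sum_(y <- B) \sum_(z <- A) delta0 (x - y - z).
  rewrite Sab exchange_big /=; apply: eq_bigr => y _; apply: eq_bigr => z _.
  by rewrite -(acf_even acf_delta0) opprB.
have EA : \sum_(y <- A) \sum_(z <- A) a^-1 / a * delta0 (y - z) = walk s 0.
  rewrite /walk /autocorr [RHS]mulrC mulr_sumr -/A -/a.
  apply: eq_bigr => y _; rewrite mulr_sumr; apply: eq_bigr => z _.
  by rewrite add0r expr2 invfM.
have EB : \sum_(y <- B) \sum_(z <- B) - b^-1 * - b^-1 * delta0 (x - y - (x - z)) = walk t 0.
  rewrite /walk /autocorr [RHS]mulrC mulr_sumr -/B -/b.
  apply: eq_bigr => y _; rewrite mulr_sumr; apply: eq_bigr => z _.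
  rewrite add0r expr2 invfM mulrNN -(acf_even acf_delta0).
  by congr (_ * delta0 _); ring.
rewrite EA EB.
have -> : \sum_(y <- A) \sum_(z <- B) a^-1 * - b^-1 * delta0 (y - (x - z)) = - (S / (a * b)).
  rewrite Sab -mulNr [RHS]mulrC invfM -sumrN mulr_sumr; apply: eq_bigr => y _.
  by rewrite -sumrN mulr_sumr; apply: eq_bigr => z _; ring.
have -> : \sum_(y <- B) \sum_(z <- A) - b^-1 / a * delta0 (x - y - z) = - (S / (a * b)).
  rewrite Sba -mulNr [RHS]mulrC invfM -sumrN mulr_sumr; apply: eq_bigr => y _.
  by rewrite -sumrN mulr_sumr; apply: eq_bigr => z _; ring.
rewrite size_allpairs natrM -/a -/b; lra.
Qed.

End Autocorrelation.

(** * Sums of independent blocks *)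

Section Growth.
Set Implicit Arguments.
Unset Strict Implicit.
Variable R : realType.
Implicit Types (s t X : seq R) (f : R -> R).

Lemma seq_minP (T : eqType) (h : T -> R) (s : seq T) : s != [::] ->
  exists2 x, x \in s & forall y, y \in s -> h x <= h y.
Proof.
elim: s => // x s IH _; case: (eqVneq s [::]) => [->|/IH [y ys hy]].
  by exists x; rewrite ?mem_head // => y; rewrite inE => /eqP ->.
case: (lerP (h x) (h y)) => xy.
  exists x; rewrite ?mem_head // => z; rewrite inE => /orP[/eqP -> //|/hy].
  exact: le_trans.
exists y; rewrite ?inE ?ys ?orbT // => z; rewrite inE => /orP[/eqP ->|/hy //].
exact: ltW.
Qed.

Lemma seq_maxP s : s != [::] ->
  exists2 x, x \in s & forall y, y \in s -> y <= x.
Proof.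
move/(seq_minP (fun x : R => - x)) => [x xs hx]; exists x => // y /hx.
by rewrite lerN2.
Qed.

(** For the minimum [m] and maximum [M], the sums [m + x] are at most [m + M], and the sums [M + x]
    with [x != m] exceed it. *)
Lemma sumset_double s : uniq s -> s != [::] ->
  exists t, [/\ uniq t, size t = (size s + (size s).-1)%N &
    forall z, z \in t -> exists x y, [/\ x \in s, y \in s & z = x + y]].
Proof.
move=> us s0; have [m ms hm] := seq_minP id s0; have [M Ms hM] := seq_maxP s0.
exists ([seq m + x | x <- s] ++ [seq M + x | x <- rem m s]); split.
- rewrite cat_uniq (map_inj_uniq (@addrI R m)) (map_inj_uniq (@addrI R M)).
  rewrite rem_uniq // us andbT /=.
  apply/hasPn => z /mapP[x]; rewrite mem_rem_uniq // inE => /andP[/= xm xs] ->.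
  apply/mapP => -[y ys] /eqP; apply/negP; rewrite gt_eqF //.
  have := hM _ ys; have := hm _ xs; rewrite /= => h1 h2.
  have : m < x by rewrite lt_neqAle eq_sym xm.
  lra.
- by rewrite size_cat !size_map size_rem.
- move=> z; rewrite mem_cat => /orP[] /mapP[x xs ->].
    by exists m, x.
  by exists M, x; split=> //; apply: mem_rem xs.
Qed.

(** By [acf_triangle], each doubling of the set costs a factor 4 in the defect. *)
Lemma sumset_iter f X e h : acf f -> uniq X -> X != [::] ->
  (forall x, x \in X -> f 0 - f x <= e) ->
  exists X', [/\ uniq X', (size X' = 2 ^ h * (size X).-1 + 1)%N &
    forall x, x \in X' -> f 0 - f x <= 4 ^+ h * e].
Proof.
move=> af uX X0 HX; elim: h => [|h [Y [uY sY HY]]].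
  exists X; split=> //; first by case: (X) X0 => //= x l _; rewrite expn0 mul1n addn1.
  by move=> x /HX; rewrite expr0 mul1r.
have Y0 : Y != [::] by rewrite -size_eq0 sY addn1.
have [Z [uZ sZ HZ]] := sumset_double uY Y0.
exists Z; split=> //; first by rewrite sZ sY expnS -mulnA; move: (_ ^ h * _)%N => N; lia.
move=> z /HZ [x [y [xY yY ->]]].
have := acf_triangle af x y; have := HY _ xY; have := HY _ yY.
rewrite exprS; lra.
Qed.

Lemma pow4_between (d : R) : 0 < d -> d <= 2^-1 ->
  exists h : nat, (8^-1 < 4 ^+ h * d) /\ (4 ^+ h * d <= 2^-1).
Proof.
move=> d0 d1.
have ex : exists n : nat, 2^-1 < 4 ^+ n * d.
  have [n hn] : exists n : nat, d^-1 < n%:R.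
    by exists (Num.truncn d^-1).+1; rewrite truncnS_gt // ?num_real.
  exists n; have n4 : n%:R <= 4 ^+ n :> R.
    by rewrite -natrX ler_nat ltnW // ltn_expl.
  have : 1 < 4 ^+ n * d by rewrite -ltr_pdivrMr // mul1r (lt_le_trans hn).
  lra.
(* Exponent 0 does not overshoot since [d <= 1/2]; the predecessor of the least overshooting
   exponent is the witness. *)
case: (ex_minnP ex) => [[|h]] h1 h2; first by move: h1; rewrite expr0; lra.
exists h; split; first by move: h1; rewrite exprS; lra.
by rewrite leNgt; apply/negP => /h2; rewrite ltnn.
Qed.

(* Nash-type inequality: near-invariance under [m] shifts gives, after [h]
   doublings, half-invariance under [2^h m / 2] shifts, which caps [f 0]. *)
Lemma acf_nash f X d : acf f -> uniq X -> (1 < size X)%N -> 0 < d -> d <= 2^-1 ->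
  (forall x, x \in X -> f 0 - f x <= d * f 0) ->
  (f 0 * (size X)%:R) ^+ 2 <= 128 * d.
Proof.
move=> af uX X2 d0 d1 HX; have X0 : X != [::] by case: (X) X2.
have [h [h1 h2]] := pow4_between d0 d1.
have [Y [uY sY HY]] := sumset_iter h af uX X0 HX.
have f0 := acf_ge0 af 0.
(* Each point of [Y] carries mass at least [f 0 / 2], and the total mass is at most 1. *)
have H : f 0 / 2 * (size Y)%:R <= 1.
  apply: le_trans (acf_mass af uY).
  rewrite mulr_natr -iter_addr_0 -[size Y]count_predT -big_const_seq.
  rewrite big_seq [leRHS]big_seq; apply: ler_sum => x /HY.
  have := ler_wpM2r f0 h2; lra.
have sXY : 2 ^+ h * (size X)%:R / 2 <= (size Y)%:R :> R.
  rewrite ler_pdivrMr // -natrX -!natrM ler_nat sY.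
  have : (size X <= (size X).-1 * 2)%N by lia.
  move/(leq_mul (leqnn (2 ^ h))); lia.
set m := (size X)%:R in sXY *.
have m0 : 0 <= m by rewrite ler0n.
have H1 : f 0 * m * 2 ^+ h <= 4.
  have := ler_wpM2l f0 sXY; lra.
have H2 : (f 0 * m * 2 ^+ h) ^+ 2 <= 16.
  have -> : 16 = 4 ^+ 2 :> R by rewrite -natrX.
  by rewrite ler_sqr ?nnegrE // !mulr_ge0 // exprn_ge0.
have E4 : (2 ^+ h) ^+ 2 = 4 ^+ h :> R by rewrite exprAC -natrX.
have P : 0 < 4 ^+ h :> R by rewrite exprn_gt0.
rewrite exprMn E4 in H2.
have : (f 0 * m) ^+ 2 * 4 ^+ h <= 128 * d * 4 ^+ h by lra.
by rewrite ler_pM2r.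
Qed.

(** The value at 0 pairs [f] with the law of the difference of two entries of [t]; [V] may be any
    duplicate-free list containing all differences. *)
Lemma autocorr_0E t f V : uniq V ->
  (forall y z, y \in t -> z \in t -> y - z \in V) ->
  autocorr t f 0 = \sum_(v <- V) autocorr t (@delta0 R) v * f v.
Proof.
move=> uV HV; rewrite /autocorr.
under [RHS]eq_bigr => v _ do rewrite mulrAC.
rewrite -mulr_suml; congr (_ / _).
under [RHS]eq_bigr => v _ do rewrite exchange_big mulr_suml.
rewrite [RHS]exchange_big /=; apply: eq_big_seq => y yt.
under [RHS]eq_bigr => v _ do rewrite mulr_suml.
rewrite [RHS]exchange_big /=; apply: eq_big_seq => z zt.
transitivity (\sum_(v <- V) (v == y - z)%:R * f (y - z)).
  by rewrite -mulr_suml sum_eq_uniq // HV // mul1r add0r.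
apply: eq_bigr => v _; rewrite /delta0.
have -> : v + z - y = v - (y - z) by ring.
by rewrite subr_eq0; case: eqP => [->|]; rewrite ?mul0r.
Qed.

Definition differences t := undup [seq y - z | y <- t, z <- t].

Lemma autocorr_0_differences t f : autocorr t f 0 =
  \sum_(v <- differences t) autocorr t (@delta0 R) v * f v.
Proof.
apply: autocorr_0E; first exact: undup_uniq.
by move=> y z yt zt; rewrite mem_undup; apply: allpairs_f.
Qed.

Lemma autocorr_mass1 t : t != [::] ->
  \sum_(v <- differences t) autocorr t (@delta0 R) v = 1.
Proof.
move=> t0; transitivity (autocorr t (fun=> 1) 0).
  by rewrite autocorr_0_differences; apply: eq_bigr => v _; rewrite mulr1.
rewrite /autocorr !big_const_seq !count_predT !iter_addr_0 expr2 mulr_natr divff //.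
by rewrite -mulr_natr mulf_neq0 // pnatr_eq0 size_eq0.
Qed.

(** In the pairing of the two laws, the difference law is bounded by its maximum and [f] by its
    total mass. *)
Lemma autocorr_0_le_mass t f : t != [::] -> acf f ->
  autocorr t f 0 <= autocorr t (@delta0 R) 0.
Proof.
move=> t0 af; have at0 := acf_autocorr t0 (@acf_delta0 R).
rewrite autocorr_0_differences.
apply: (@le_trans _ _ (\sum_(v <- differences t) autocorr t (@delta0 R) 0 * f v)).
  apply: ler_sum => v _; apply: ler_wpM2r; first exact: acf_ge0.
  exact: acf_le0.
by rewrite -mulr_sumr ler_piMr ?acf_ge0 // acf_mass // undup_uniq.
Qed.

(** A smaller loss would mean that [f] is nearly invariant under most differences of [t]. As each
    difference has probability at most [p], there are more than [3 / (4 p)] such shifts,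
    contradicting [acf_nash]. *)
Lemma autocorr_0_decr t f : t != [::] -> acf f ->
  let p := autocorr t (@delta0 R) 0 in p <= 2^-1 -> 0 < p -> 0 < f 0 -> f 0 <= 2 * p ->
  autocorr t f 0 <= f 0 * (1 - 1000^-1 * (f 0 / p) ^+ 2).
Proof.
move=> t0 af p p1 p0 f0 f0p; have at0 := acf_autocorr t0 (@acf_delta0 R).
(* The threshold [d] is four times the claimed relative loss [x / 1000], so less than a quarter of
   the mass lies on shifts losing more than [d * f 0]. *)
set x := (f 0 / p) ^+ 2; set d : R := 4 / 1000 * x.
have fp0 : 0 < f 0 / p by rewrite divr_gt0.
have x0 : 0 < x by rewrite exprn_gt0.
have x4 : x <= 4.
  have -> : 4 = 2 ^+ 2 :> R by rewrite -natrX.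
  by rewrite ler_sqr ?nnegrE ?(ltW fp0) // ler_pdivrMr.
rewrite leNgt; apply/negP => big.
set X := [seq v <- differences t | f 0 - f v <= d * f 0].
have uX : uniq X by rewrite filter_uniq // undup_uniq.
(* Shifts outside [X] lose at least [d * f 0]; those in [X] have probability at most [p] each. *)
have H : autocorr t f 0 <= f 0 * (1 - d) + d * f 0 * (p * (size X)%:R).
  rewrite autocorr_0_differences.
  have -> : f 0 * (1 - d) =
      \sum_(v <- differences t) autocorr t (@delta0 R) v * (f 0 * (1 - d)).
    by rewrite -mulr_suml autocorr_mass1 // mul1r.
  have -> : p * (size X)%:R =
      \sum_(v <- differences t) if f 0 - f v <= d * f 0 then p else 0.
    rewrite -big_mkcond -big_filter /=.
    by rewrite big_const_seq count_predT iter_addr_0 mulr_natr.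
  rewrite mulr_sumr -big_split /=.
  apply: ler_sum => v _.
  have pv : autocorr t (@delta0 R) v <= p by exact: acf_le0.
  have pv0 := acf_ge0 at0 v; set q := autocorr _ _ _ in pv pv0 *.
  have df0 : 0 <= d * f 0 by rewrite mulr_ge0 ?ltW // /d; lra.
  case: ifP => [h|/negbT]; last rewrite -ltNge => h.
    have h1 : q * f v <= q * f 0 by rewrite ler_wpM2l // acf_le0.
    have h2 : q * (d * f 0) <= d * f 0 * p by rewrite mulrC ler_wpM2l.
    lra.
  have : q * (d * f 0) <= q * (f 0 - f v) by rewrite ler_wpM2l // ltW.
  lra.
have fd0 : 0 < d * f 0 by rewrite mulr_gt0 // /d; lra.
have HX : 3 / 4 < p * (size X)%:R.
  have : d * f 0 * (3 / 4) < d * f 0 * (p * (size X)%:R).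
    apply: lt_le_trans (_ : autocorr t f 0 - f 0 * (1 - d) <= _); last by lra.
    move: big; rewrite -/x /d; lra.
  by rewrite ltr_pM2l.
have X2 : (1 < size X)%N.
  rewrite ltnNge; apply/negP => X1.
  have : p * (size X)%:R <= 2^-1 * 1.
    by rewrite ler_pM ?ler0n // ?(ltW p0) // lern1.
  lra.
have d0 : 0 < d by rewrite /d; lra.
have d2 : d <= 2^-1 by rewrite /d; lra.
have := acf_nash af uX X2 d0 d2.
have XH v : v \in X -> f 0 - f v <= d * f 0 by rewrite mem_filter => /andP[].
move/(_ XH).
(* The square exceeds [x * 9/16], whereas [128 * d] is only [0.512 * x]. *)
apply/negP; rewrite -ltNge.
have -> : f 0 * (size X)%:R = f 0 / p * (p * (size X)%:R).
  by rewrite mulrA mulfVK // gt_eqF.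
rewrite exprMn -/x.
have : x * (3 / 4) ^+ 2 < x * (p * (size X)%:R) ^+ 2.
  by rewrite ltr_pM2l // ltr_sqr ?nnegrE //; lra.
rewrite /d; lra.
Qed.

(** The weight [w] is a lower bound for [1 / f(0)^2]; one more block with collision probability [p]
    raises it by [1 / (1000 p^2)]. *)
Lemma autocorr_0_step t f w : t != [::] -> acf f ->
  let p := autocorr t (@delta0 R) 0 in p <= 2^-1 -> 0 < p -> 0 <= w ->
  f 0 ^+ 2 * w <= 1 -> autocorr t f 0 ^+ 2 * (w + 1000^-1 / p ^+ 2) <= 1.
Proof.
move=> t0 af p p1 p0 w0 fw; have at0 := acf_autocorr t0 (@acf_delta0 R).
set f1 := autocorr t f 0.
have f10 : 0 <= f1 by apply: acf_ge0; apply: acf_autocorr.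
have f1f : f1 <= f 0 by exact: autocorr_0_le.
have f1p : f1 <= p by exact: autocorr_0_le_mass.
have p20 : 0 < p ^+ 2 by rewrite exprn_gt0.
have E1 : f1 ^+ 2 / p ^+ 2 <= 1.
  by rewrite ler_pdivrMr // mul1r ler_sqr ?nnegrE ?(ltW p0).
(* If [f 0 > 2 * p], then [f1 <= p] already more than halves the value. Otherwise [autocorr_0_decr]
   applies, and [(1 - y) * (1 + y) <= 1] closes the step. *)
case: (lerP (f 0) (2 * p)) => fp; last first.
  have : f1 ^+ 2 * w <= 4^-1 * (f 0 ^+ 2 * w).
    rewrite mulrA ler_wpM2r //.
    have : f1 ^+ 2 <= (f 0 / 2) ^+ 2 by rewrite ler_sqr ?nnegrE; lra.
    rewrite !expr2; lra.
  rewrite mulrDr mulrCA; lra.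
case: (ltrP 0 (f 0)) => f0; last first.
  have -> : f1 = 0 by apply/eqP; rewrite eq_le f10 andbT; lra.
  by rewrite expr0n mul0r ler01.
have H := autocorr_0_decr t0 af p1 p0 f0 fp; rewrite -/p -/f1 in H.
clearbody p f1.
set y := 1000^-1 * (f 0 / p) ^+ 2 in H.
have c0 : 0 <= 1000^-1 :> R by rewrite invr_ge0 ler0n.
have y0 : 0 <= y by apply: mulr_ge0; [exact: c0 | exact: sqr_ge0].
have ley : y <= 1.
  have : (f 0 / p) ^+ 2 <= 2 ^+ 2.
    have r0 : 0 <= f 0 / p by apply: divr_ge0; exact: ltW.
    by rewrite ler_sqr ?nnegrE // ler_pdivrMr.
  rewrite /y [2 ^+ 2]expr2; lra.
have H2 : f1 ^+ 2 <= f 0 ^+ 2 * (1 - y).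
  apply: (@le_trans _ _ ((f 0 * (1 - y)) ^+ 2)).
    have q0 : 0 <= f 0 * (1 - y) by apply: mulr_ge0; lra.
    by rewrite ler_sqr ?nnegrE.
  have : 0 <= y * (1 - y) by apply: mulr_ge0 => //; lra.
  rewrite exprMn => yy; apply: ler_wpM2l; first exact: sqr_ge0.
  rewrite expr2; lra.
have Ey : f 0 ^+ 2 * (1000^-1 / p ^+ 2) = y by rewrite /y mulrCA expr_div_n.
have K0 : 0 <= w + 1000^-1 / p ^+ 2 by apply: addr_ge0; [exact: w0 | apply: divr_ge0; [exact: c0 | exact: ltW]].
apply: le_trans (ler_wpM2r K0 H2) _.
have : f 0 ^+ 2 * (1 - y) * (w + 1000^-1 / p ^+ 2) = (1 - y) * (f 0 ^+ 2 * w + y).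
  by rewrite -Ey; ring.
move=> ->.
apply: (@le_trans _ _ ((1 - y) * (1 + y))); first by rewrite ler_wpM2l; lra.
have := sqr_ge0 y; rewrite expr2; lra.
Qed.

Lemma walk_flatten_le (Bs : seq (seq R)) :
  (forall B, B \in Bs -> walk B 0 <= 2^-1) -> (forall B, B \in Bs -> 0 < walk B 0) ->
  walk (flatten Bs) 0 ^+ 2 * (\sum_(B <- Bs) 1000^-1 / walk B 0 ^+ 2) <= 1.
Proof.
elim: Bs => [|B Bs IH] h1 h2; first by rewrite big_nil mulr0 ler01.
rewrite big_cons /= walk_cat [X in _ * X]addrC.
apply: autocorr_0_step; [exact: subsums_neq0 | exact: acf_walk | | | |].
- by apply: h1; rewrite mem_head.
- by apply: h2; rewrite mem_head.
- apply: sumr_ge0 => C _; apply: divr_ge0; last exact: sqr_ge0.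
  by rewrite invr_ge0 ler0n.
- by apply: IH => C CB; [apply: h1 | apply: h2]; rewrite inE CB orbT.
Qed.

Lemma walk_0_gt0 s : 0 < walk s 0.
Proof.
elim: s => [|c s IH]; first by rewrite walk_nil /delta0 eqxx ltr01.
rewrite walk_cons autocorr_pair.
have := acf_ge0 (acf_walk s) (0 + c); have := acf_ge0 (acf_walk s) (0 - c).
lra.
Qed.

(* [1/p^2 >= 3 l^2 - 2 l^3 p] is the tangent of the convex map [p -> 1/p^2] at
   [1/l]; it turns the sum of inverse squares into a mean of the [walk B 0]. *)
Lemma walk_flatten_mean (Bs : seq (seq R)) : Bs != [::] ->
  (forall B, B \in Bs -> walk B 0 <= 2^-1) ->
  walk (flatten Bs) 0 <=
    32 / (Num.sqrt (size Bs)%:R * (size Bs)%:R) * \sum_(B <- Bs) walk B 0.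
Proof.
move=> Bs0 h1; have h2 B (_ : B \in Bs) := walk_0_gt0 B.
have H := walk_flatten_le h1 h2.
set N : R := (size Bs)%:R; set S := \sum_(B <- Bs) walk B 0.
have N0 : 0 < N by rewrite ltr0n lt0n size_eq0.
have S0 : 0 < S.
  rewrite /S; case: (Bs) Bs0 => // B Bs' _; rewrite big_cons.
  by apply: ltr_wpDr; rewrite ?walk_0_gt0 // sumr_ge0 // => C _; exact: walk_0_ge0.
set l := N / S; have l0 : 0 < l by rewrite divr_gt0.
have HS : N * l ^+ 2 <= \sum_(B <- Bs) 1 / walk B 0 ^+ 2.
  have -> : N * l ^+ 2 = \sum_(B <- Bs) (3 * l ^+ 2 - 2 * l ^+ 3 * walk B 0).
    rewrite sumrB big_const_seq count_predT iter_addr_0 -mulr_sumr -/S -[_ *+ size Bs]mulr_natr -/N.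
    have -> : 2 * l ^+ 3 * S = 2 * l ^+ 2 * N.
      by rewrite exprS /l; field; rewrite gt_eqF.
    ring.
  rewrite big_seq [leRHS]big_seq; apply: ler_sum => B /h2 B0.
  rewrite ler_pdivlMr ?exprn_gt0 //; set p := walk B 0 in B0 *.
  have : 0 <= (l * p - 1) ^+ 2 * (2 * (l * p) + 1).
    apply: mulr_ge0; first exact: sqr_ge0.
    by apply: addr_ge0 => //; apply: mulr_ge0 => //; rewrite mulr_ge0 ?(ltW l0) ?(ltW B0).
  have -> : (l * p - 1) ^+ 2 * (2 * (l * p) + 1) = 1 - (3 * l ^+ 2 - 2 * l ^+ 3 * p) * p ^+ 2 by ring.
  by rewrite subr_ge0.
have {}H : (walk (flatten Bs) 0) ^+ 2 * (N * l ^+ 2) <= 1000.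
  apply: le_trans (ler_wpM2l (sqr_ge0 _) HS) _.
  have E : \sum_(B <- Bs) 1000^-1 / walk B 0 ^+ 2
      = 1000^-1 * \sum_(B <- Bs) 1 / walk B 0 ^+ 2.
    by rewrite mulr_sumr; apply: eq_bigr => B _; rewrite mul1r.
  rewrite E mulrCA in H.
  by rewrite ler_pdivrMl ?ltr0n // mulr1 in H.
have sN0 : 0 < Num.sqrt N by rewrite sqrtr_gt0.
(* The constant 32 is chosen because [32^2 = 1024] exceeds 1000. *)
have E : (32 / (Num.sqrt N * N) * S) ^+ 2 = 1024 / (N * l ^+ 2).
  rewrite !exprMn exprVn exprMn sqr_sqrtr ?ltW // /l.
  have -> : 32 ^+ 2 = 1024 :> R by rewrite -natrX.
  by field; rewrite !gt_eqF.
rewrite -ler_sqr ?nnegrE ?walk_0_ge0 //; last first.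
  apply: mulr_ge0 (ltW S0); apply: divr_ge0; first by rewrite ler0n.
  by apply: ltW; apply: mulr_gt0.
have NL : 0 < N * l ^+ 2 by apply: mulr_gt0 => //; apply: exprn_gt0.
rewrite E ler_pdivlMr //; apply: le_trans H _; lra.
Qed.

End Growth.

(** * Shifts by products *)

Section ProductShifts.
Set Implicit Arguments.
Unset Strict Implicit.
Variable R : realType.
Implicit Types (s t X : seq R) (f : R -> R).

Lemma markov_count (T : Type) (r : seq T) (h : T -> R) (S c : R) :
  (forall x, 0 <= h x) -> 0 < S -> \sum_(x <- r) h x <= S * (size r)%:R ->
  (count (fun x => c * S < h x) r)%:R * c <= (size r)%:R.
Proof.
move=> h0 S0 H; rewrite -(ler_pM2l S0); apply: le_trans H.
rewrite -sum1_count natr_sum mulr_suml mulr_sumr big_mkcond /=.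
apply: ler_sum => x _; case: ifP => // hx.
by rewrite mul1r mulrC ltW.
Qed.

Lemma size_filter3 (T : Type) (r : seq T) (P1 P2 P3 : pred T) :
  (size r <= size [seq x <- r | [&& ~~ P1 x, ~~ P2 x & ~~ P3 x]]
    + count P1 r + count P2 r + count P3 r)%N.
Proof.
elim: r => //= x r IH.
by case: (P1 x); case: (P2 x); case: (P3 x) => /=; lia.
Qed.

Lemma min_gap s : uniq s -> (1 < size s)%N ->
  exists x y, [/\ x \in s, y \in s, x < y &
    forall u v, u \in s -> v \in s -> u < v -> y - x <= v - u].
Proof.
move=> us s2.
set P := [seq p <- [seq (u, v) | u <- s, v <- s] | p.1 < p.2].
have P0 : P != [::].
  case: s us s2 @P => [|x [|y s]] // us _ P.
  have xy : x != y by move: us; rewrite /= inE negb_or; case/andP => /andP[].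
  suff : has predT P by case: (P).
  apply/hasP; exists (if x < y then (x, y) else (y, x)) => //.
  by case: (ltgtP x y) xy => // h _; rewrite mem_filter; apply/andP; split => //;
    apply: allpairs_f; rewrite !inE eqxx ?orbT.
have [[x y] xyP H] := seq_minP (fun p : R * R => p.2 - p.1) P0.
move: xyP; rewrite mem_filter => /andP[/= xy /allpairsP[[x' y'] /= [xs ys [ex ey]]]].
exists x, y; split=> [||//|u v us' vs' uv]; [by rewrite ex | by rewrite ey |].
by apply: (H (u, v)); rewrite mem_filter /= uv; apply: allpairs_f.
Qed.

Lemma acf_sub_le f u v (d : R) : acf f -> f 0 - f u <= d -> f 0 - f v <= d ->
  f 0 - f (u - v) <= 4 * d.
Proof.
by move=> af; have := acf_triangle af u (- v); rewrite (acf_even af); lra.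
Qed.

(** The first term gains at least [g * (b1 - b0)], more than [g * (b - b0)]. Hence the shifts are
    ordered first by [a], whatever the second coordinates. *)
Lemma gap_shift_lt (al g b0 b1 a a' b b' : R) :
  0 < g -> g <= a' - a -> b0 <= b -> b < b1 -> b0 <= b' ->
  (a - al) * (b1 - b0) + g * (b - b0) < (a' - al) * (b1 - b0) + g * (b' - b0).
Proof.
move=> g0 ga b0b bb1 b0b'.
have h3 : g * (b1 - b0) <= (a' - a) * (b1 - b0) by apply: ler_wpM2r => //; lra.
have h4 : 0 < g * (b1 - b0 + (b' - b0) - (b - b0)) by apply: mulr_gt0; lra.
lra.
Qed.

(* The shifts [(a - al)(b1 - b0) + (a2 - a1)(b - b0)] are sums of six products
   [(a' - al)(b' - be)]; with [a2 - a1] the least gap and [b0 <= b < b1] they are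
   pairwise distinct. *)
Lemma acf_product_shifts f (va vb : seq R) (al be : R) :
  acf f -> uniq va -> uniq vb -> (1 < size va)%N -> (1 < size vb)%N ->
  9 < f 0 * ((size va)%:R * (size vb)%:R) ->
  f 0 * ((size va)%:R * (size vb)%:R) / 8000 <=
  \sum_(a <- va) \sum_(b <- vb) (f 0 - f ((a - al) * (b - be))).
Proof.
move=> af ua ub sa sb big; rewrite leNgt; apply/negP => small.
pose N a b := f 0 - f ((a - al) * (b - be)).
have N0 a b : 0 <= N a b by rewrite subr_ge0 acf_le0.
set k : R := (size va)%:R in big small; set l : R := (size vb)%:R in big small.
have k2 : 2 <= k by rewrite ler_nat.
have l2 : 2 <= l by rewrite ler_nat.
have kp : 0 < k by exact: lt_le_trans k2.
have lp : 0 < l by exact: lt_le_trans l2.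
have f0 : 0 < f 0.
  rewrite lt_neqAle acf_ge0 // andbT eq_sym; apply/negP => /eqP f0.
  by move: big; rewrite f0 mul0r; lra.
(* Three nested uses of [acf_triangle] on six products of defect at most [d] give a defect of at
   most [40 * d = f 0 / 2]. In terms of [d], the assumed average defect is below [d / 100]. *)
set d : R := f 0 / 80; have d0 : 0 < d by rewrite /d; lra.
have d25 : 25 * (d / 25) = d by rewrite mulrC divfK.
pose badb b := 4 * (d / 100 * k) < \sum_(a <- va) N a b.
pose bada a := 4 * (d / 100 * l) < \sum_(b <- vb) N a b.
have cb : (count badb vb)%:R * 4 <= l.
  apply: markov_count; first by move=> b; exact: sumr_ge0.
    by apply: mulr_gt0 => //; exact: divr_gt0.
  by rewrite exchange_big -/l; apply: ltW; apply: lt_le_trans small _; rewrite /d; lra.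
have ca : (count bada va)%:R * 4 <= k.
  apply: markov_count; first by move=> b; exact: sumr_ge0.
    by apply: mulr_gt0 => //; exact: divr_gt0.
  by rewrite -/k; apply: ltW; apply: lt_le_trans small _; rewrite /d; lra.
have cab b : ~~ badb b -> (count (fun a => d < N a b) va)%:R * 25 <= k.
  rewrite -leNgt => hb; rewrite -d25; apply: markov_count => //; first by lra.
  by apply: le_trans hb _; rewrite -/k; lra.
have cba a : ~~ bada a -> (count (fun b => d < N a b) vb)%:R * 25 <= l.
  rewrite -leNgt => hb; rewrite -d25; apply: markov_count => //; first by lra.
  by apply: le_trans hb _; rewrite -/l; lra.
set E := [seq b <- vb | ~~ badb b].
have E0 : E != [::].
  have := size_filter3 vb badb pred0 pred0; rewrite count_pred0 !addn0.
  under eq_filter => b do rewrite /= andbT.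
  rewrite -/E => h; apply/negP => /eqP E0; move: h; rewrite E0 /= add0n.
  by rewrite -(ler_nat R) -/l; lra.
have [b0 b0E hb0] := seq_minP id E0; have [b1 b1E hb1] := seq_maxP E0.
have b0g : ~~ badb b0 by move: b0E; rewrite mem_filter => /andP[].
have b1g : ~~ badb b1 by move: b1E; rewrite mem_filter => /andP[].
(* By Markov's inequality at most a quarter of the rows are bad, and each good column excludes at
   most 1/25 of them: [1 - 1/4 - 2/25 = 67/100] remain. *)
set D := [seq a <- va | [&& ~~ bada a, ~~ (d < N a b0) & ~~ (d < N a b1)]].
have DP a : a \in D -> [/\ ~~ bada a, N a b0 <= d & N a b1 <= d].
  by rewrite mem_filter -!leNgt => /andP[/and3P[]].
have uD : uniq D by rewrite filter_uniq.
have sD : 67 / 100 * k <= (size D)%:R.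
  have := size_filter3 va bada (fun a => d < N a b0) (fun a => d < N a b1).
  rewrite -/D -(ler_nat R) !natrD -/k; have := cab _ b0g; have := cab _ b1g.
  by move: ca; clear; lra.
have D2 : (1 < size D)%N.
  by rewrite ltnNge; apply/negP; rewrite -(ler_nat R); move: sD k2; clear; lra.
have [a1 [a2 [a1D a2D a12 gap]]] := min_gap uD D2.
have [a1g a1b0 a1b1] := DP _ a1D; have [a2g a2b0 a2b1] := DP _ a2D.
set F := [seq b <- vb | [&& ~~ badb b, ~~ (d < N a1 b) & ~~ (d < N a2 b)]].
have uF : uniq F by rewrite filter_uniq.
have FP b : b \in F -> [/\ b \in E, N a1 b <= d & N a2 b <= d].
  by rewrite !mem_filter -!leNgt => /andP[/and3P[-> -> ->] ->].
have sF : 67 / 100 * l <= (size F)%:R.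
  have := size_filter3 vb badb (fun b => d < N a1 b) (fun b => d < N a2 b).
  rewrite -/F -(ler_nat R) !natrD -/l; have := cba _ a1g; have := cba _ a2g.
  by move: cb; clear; lra.
have F2 : (1 < size F)%N.
  by rewrite ltnNge; apply/negP; rewrite -(ler_nat R); move: sF l2; clear; lra.
(* Dropping [b1] makes [b < b1] strict, as [gap_shift_lt] requires; at least half of [F] is left. *)
set F' := [seq b <- F | b != b1].
have F'P b : b \in F' -> b != b1 /\ b \in F by rewrite mem_filter => /andP[].
have sF' : (size F)%:R <= 2 * (size F')%:R :> R.
  have : (size F <= size F' + 1)%N.
    rewrite /F' size_filter -(count_predC (fun b => b != b1) F) leq_add2l.
    rewrite (eq_count (_ : _ =1 pred1 b1)) ?count_uniq_mem ?leq_b1 //.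
    by move=> b /=; rewrite negbK.
  rewrite -natrM ler_nat mul2n -addnn => h.
  apply: (leq_trans h); rewrite leq_add2l.
  by move: h; case: (size F') => //; rewrite add0n leqNgt F2.
pose sh a b := (a - al) * (b1 - b0) + (a2 - a1) * (b - b0).
set X := [seq sh a b | a <- D, b <- F'].
have uX : uniq X.
  apply: allpairs_uniq => //; first by rewrite filter_uniq.
  have lt_sh a b a' b' : a \in D -> a' \in D -> b \in F' -> b' \in F' -> a < a' ->
      sh a b < sh a' b'.
    move=> aD a'D /F'P[b1n bF] /F'P[b1n' b'F] aa'.
    have [bE _ _] := FP _ bF; have [b'E _ _] := FP _ b'F.
    have g1 := gap _ _ aD a'D aa'.
    have h1 : b < b1 by rewrite lt_neqAle b1n hb1.
    by apply: gap_shift_lt; rewrite ?subr_gt0 //; exact: hb0.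
  move=> [a b] [a' b'] /allpairsP[[x y] /= [xD yF [-> ->]]].
  move=> /allpairsP[[x' y'] /= [x'D y'F [-> ->]]] eq.
  case: (ltgtP x x') => [h|h|h].
  - by have := lt_sh _ y _ y' xD x'D yF y'F h; rewrite eq ltxx.
  - by have := lt_sh _ y' _ y x'D xD y'F yF h; rewrite eq ltxx.
  move: eq; rewrite /sh h => /addrI /(mulfI _) /addIr -> //.
  by rewrite subr_eq0 gt_eqF.
have sX : (67 / 100) ^+ 2 / 2 * (k * l) <= (size X)%:R.
  rewrite size_allpairs natrM.
  have : 67 / 100 * k * (67 / 100 * l / 2) <= (size D)%:R * (size F')%:R.
    apply: ler_pM => //; try by rewrite !mulr_ge0 ?invr_ge0 ?ler0n.
    by rewrite ler_pdivrMr // [_ * 2]mulrC; exact: le_trans sF sF'.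
  by clear; rewrite expr2; lra.
have HX x : x \in X -> f 0 / 2 <= f x.
  move=> /allpairsP[[a b] /= [aD]]; rewrite mem_filter => /andP[_ bF] ->.
  have [_ ab0 ab1] := DP _ aD; have [_ a1b a2b] := FP _ bF.
  pose q u v := (u - al) * (v - be).
  have NN u v u' v' : N u v <= d -> N u' v' <= d -> f 0 - f (q u v - q u' v') <= 4 * d.
    exact: acf_sub_le.
  have -> : sh a b = (q a b1 - q a b0) + ((q a2 b - q a1 b) + (q a1 b0 - q a2 b0)).
    by rewrite /sh /q; ring.
  have := acf_triangle af (q a b1 - q a b0) ((q a2 b - q a1 b) + (q a1 b0 - q a2 b0)).
  have := acf_triangle af (q a2 b - q a1 b) (q a1 b0 - q a2 b0).
  have := NN _ _ _ _ ab1 ab0; have := NN _ _ _ _ a2b a1b; have := NN _ _ _ _ a1b0 a2b0.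
  by rewrite /d; clear; lra.
have H : f 0 / 2 * (size X)%:R <= 1.
  apply: le_trans (acf_mass af uX).
  rewrite mulr_natr -iter_addr_0 -[size X]count_predT -big_const_seq.
  by rewrite big_seq [leRHS]big_seq; apply: ler_sum => x /HX.
(* This forces [f 0 * (k * l) <= 4 / 0.67^2], which is below the assumed 9. *)
have : f 0 / 2 * ((67 / 100) ^+ 2 / 2 * (k * l)) <= 1.
  by apply: le_trans H; rewrite ler_pM2l // divr_gt0.
have -> : f 0 / 2 * ((67 / 100) ^+ 2 / 2 * (k * l)) = (67/100) ^+ 2 / 4 * (f 0 * (k * l)) by field.
by move: big; clear; rewrite expr2; lra.
Qed.

End ProductShifts.

(** * Random permutations and independent sampling *)

Section RandomPermutations.
Set Implicit Arguments.
Unset Strict Implicit.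
Variables (R : realType) (T : finType).
Implicit Types (A B : {set T}) (w : seq T) (k : T -> R) (F G : seq T -> R).

(** Expectation over a list of independent coordinates, the i-th one distributed by the i-th weight
    function. *)
Fixpoint expect (ks : seq (T -> R)) F : R :=
  if ks is k :: ks' then \sum_x k x * expect ks' (fun s => F (x :: s)) else F [::].

Fixpoint weight (ks : seq (T -> R)) (s : seq T) : R :=
  match ks, s with k :: ks', x :: s' => k x * weight ks' s' | _, _ => 1 end.

Lemma sum_tuple_cons m G :
  \sum_(v : m.+1.-tuple T) G v = \sum_x \sum_(v : m.-tuple T) G (x :: v).
Proof.
rewrite pair_big /=.
rewrite (reindex (fun p : T * m.-tuple T => [tuple of p.1 :: p.2])) //=.
apply: onW_bij; exists (fun v => (thead v, behead_tuple v)).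
  by move=> [x v] /=; rewrite theadE; congr (_, _); apply: val_inj.
by move=> v; rewrite [in RHS](tuple_eta v); apply: val_inj.
Qed.

Lemma expect_tuple ks F :
  expect ks F = \sum_(v : (size ks).-tuple T) weight ks v * F v.
Proof.
elim: ks F => [|k ks IH] F /=.
  rewrite (big_pred1 [tuple]) ?mul1r // => v.
  by apply/esym/eqP; exact: tuple0.
rewrite (sum_tuple_cons _ (fun v => weight (k :: ks) v * F v)).
apply: eq_bigr => x _; rewrite IH mulr_sumr; apply: eq_bigr => v _ /=.
by rewrite mulrA.
Qed.

Lemma expect_sum (I : finType) (c : I -> R) (H : I -> seq T -> R) ks :
  expect ks (fun s => \sum_i c i * H i s) = \sum_i c i * expect ks (H i).
Proof.
elim: ks H => [|k ks IH] H //=.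
under eq_bigr => x _ do rewrite (IH (fun i s => H i (x :: s))) mulr_sumr.
rewrite exchange_big /=; apply: eq_bigr => i _; rewrite mulr_sumr.
by apply: eq_bigr => x _; rewrite mulrCA.
Qed.

Lemma eq_expect ks F G : F =1 G -> expect ks F = expect ks G.
Proof.
elim: ks F G => [|k ks IH] F G FG /=; first exact: FG.
by apply: eq_bigr => x _; congr (_ * _); apply: IH.
Qed.

Lemma expectZ (c : R) F ks : expect ks (fun s => c * F s) = c * expect ks F.
Proof.
elim: ks F => [|k ks IH] F //=; rewrite mulr_sumr; apply: eq_bigr => x _.
by rewrite (IH (fun s => F (x :: s))) mulrCA.
Qed.

Lemma expectD F G ks : expect ks (fun s => F s + G s) = expect ks F + expect ks G.
Proof.
elim: ks F G => [|k ks IH] F G //=; rewrite -big_split; apply: eq_bigr => x _ /=.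
by rewrite (IH (fun s => F (x :: s)) (fun s => G (x :: s))) mulrDr.
Qed.

Definition stochastic k := (forall x, 0 <= k x) /\ \sum_x k x = 1.

Definition unif A (x : T) : R := (x \in A)%:R / #|A|%:R.

(** The law of the image of [y] under a uniformly random permutation supported on [A]. *)
Definition kern A (y : T) : T -> R :=
  if y \in A then unif A else fun x => (x == y)%:R.

Lemma sum_mem A : \sum_x (x \in A)%:R = #|A|%:R :> R.
Proof.
rewrite -sum1_card natr_sum [RHS]big_mkcond; apply: eq_bigr => x _.
by case: (x \in A).
Qed.

Lemma unif_stochastic A : (0 < #|A|)%N -> stochastic (unif A).
Proof.
move=> A0; split; first by move=> x; rewrite divr_ge0 ?ler0n.
by rewrite -mulr_suml sum_mem divff // pnatr_eq0 -lt0n.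
Qed.

Lemma kern_stochastic A y : (0 < #|A|)%N -> stochastic (kern A y).
Proof.
rewrite /kern; case: ifP => _; first exact: unif_stochastic.
split=> [x|]; first exact: ler0n.
by rewrite (bigD1 y) //= eqxx big1 ?addr0 // => x /negPf ->.
Qed.

(** Compares sampling with and without replacement: [r] draws from [m] are distinct with probability
    at least [1 - r^2 / m]. *)
Lemma expn_le_ffact m r : (2 * r ^ 2 <= m)%N -> (m ^ r <= 2 * m ^_ r)%N.
Proof.
have H : forall r, (m ^ r * (m - r ^ 2) <= m ^_ r * m)%N.
  elim=> [|r' IH]; first by rewrite expn0 ffactn0 !mul1n leq_subr.
  (* Once the square exceeds [m], the truncated subtraction makes the left side 0. *)
  case: (leqP (r'.+1 ^ 2) m) => hr; last first.
    by have -> : (m - r'.+1 ^ 2 = 0)%N; [apply/eqP; rewrite subn_eq0 ltnW | rewrite muln0].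
  have h1 : (m ^ r'.+1 * (m - r'.+1 ^ 2) <= m ^ r' * (m - r' ^ 2) * (m - r'))%N.
    rewrite expnSr -!mulnA leq_mul2l; apply/orP; right.
    move: hr => /subnKC <-; set t := (m - r'.+1 ^ 2)%N.
    have -> : (r'.+1 ^ 2 + t - r'.+1 ^ 2 = t)%N by rewrite addKn.
    have -> : (r'.+1 ^ 2 + t - r' ^ 2 = t + 2 * r' + 1)%N by rewrite -!mulnn; nia.
    have -> : (r'.+1 ^ 2 + t - r' = t + r' * r' + r' + 1)%N by rewrite -mulnn; nia.
    by rewrite -mulnn; nia.
  apply: (leq_trans h1); rewrite ffactnSr.
  have := leq_mul IH (leqnn (m - r')%N); lia.
case: m H => [|m] H.
  by case: r => [|r]; rewrite ?expn0 ?ffactn0.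
move=> h; have := H r; have : (m.+1 <= 2 * (m.+1 - r ^ 2))%N by lia.
move=> h1 h2.
rewrite -(@leq_pmul2r m.+1) //.
apply: (@leq_trans (m.+1 ^ r * (2 * (m.+1 - r ^ 2)))); first by rewrite leq_mul2l h1 orbT.
by rewrite mulnCA -mulnA leq_mul2l.
Qed.

Lemma weight_kern A w (p : {perm T}) : perm_on A p ->
  weight (map (kern A) w) (map p w) = (#|A|%:R ^+ count (mem A) w)^-1.
Proof.
move=> pA; elim: w => [|y w IH] /=; first by rewrite expr0 invr1.
rewrite IH /kern; case: ifP => yA.
  by rewrite /unif perm_closed // yA mul1r exprD expr1 invfM.
by rewrite (out_perm pA) ?yA // eqxx mul1r.
Qed.

(** Composing with the inverse of one such permutation injects the set into the permutations
    supported on [A] minus [w]. *)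
Lemma card_perm_on_map A w v : uniq w ->
  (#|[set p : {perm T} | perm_on A p & map p w == v]|
     <= (#|A| - count (mem A) w)`!)%N.
Proof.
move=> uw; set K := [set p | _ & _].
case: (set_0Vmem K) => [->|[p0]]; first by rewrite cards0.
rewrite inE => /andP[p0A /eqP p0v].
have -> : (#|A| - count (mem A) w = #|A :\: [set x in w]|)%N.
  rewrite -(cardsID [set x in w] A) addnC.
  suff -> : #|A :&: [set x in w]| = count (mem A) w by rewrite addnK.
  rewrite -size_filter -(card_uniqP (filter_uniq _ uw)).
  by apply: eq_card => x; rewrite !inE mem_filter.
rewrite -card_perm -(card_imset _ (mulIg p0^-1)%g).
apply: subset_leq_card; apply/fintype.subsetP => q /imsetP[p].
rewrite inE => /andP[pA /eqP pv] ->.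
apply/fintype.subsetP => x; rewrite inE permM; apply: contraR.
rewrite !inE negb_and negbK => /orP[xw|xA].
  suff -> : p x = p0 x by rewrite permK.
  by move: pv; rewrite -p0v => /eq_in_map; apply.
by rewrite (out_perm pA xA) -{1}(out_perm p0A xA) permK.
Qed.

(** A given list of images has probability at most [1 / m^_r], where [m] is the size of [A] and [r]
    the number of entries of [w] in it. By [expn_le_ffact] this is at most twice the independent
    probability [m^-r]. *)
Lemma perm_on_expect A w F : uniq w -> (forall s, 0 <= F s) ->
  (2 * size w ^ 2 <= #|A|)%N ->
  \sum_(p : {perm T} | perm_on A p) F (map p w)
     <= 2 * (#|A|)`!%:R * expect (map (kern A) w) F.
Proof.
move=> uw F0 wA; rewrite expect_tuple size_map mulr_sumr.
pose h (p : {perm T}) : (size w).-tuple T := map_tuple p (in_tuple w).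
rewrite (partition_big h xpredT) //=; apply: ler_sum => v _.
rewrite (eq_bigr (fun=> F v)); last by move=> p /andP[_ /eqP <-].
rewrite sumr_const mulrA -[F v *+ _]mulr_natl; apply: ler_wpM2r => //.
have -> : #|(fun p => perm_on A p && (h p == v))|
   = #|[set p : {perm T} | perm_on A p & map p w == v]|.
  by apply: eq_card => p; rewrite !inE.
set K := [set p | _ & _].
case: (set_0Vmem K) => [->|[p0]].
  rewrite cards0; apply: mulr_ge0; first by rewrite mulr_ge0 ?ler0n.
  elim: (w) (tval v) => [|y w' IH] [|x s] //=; rewrite mulr_ge0 //.
  rewrite /kern /unif; case: ifP => _; last exact: ler0n.
  by rewrite divr_ge0 ?ler0n.
rewrite inE => /andP[p0A /eqP <-]; rewrite weight_kern //.
set r := count _ w.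
have rA : (2 * r ^ 2 <= #|A|)%N.
  by apply: leq_trans wA; rewrite leq_mul2l leq_sqr count_size.
have rm : (r <= #|A|)%N.
  by apply: leq_trans rA; rewrite -mulnn; nia.
have A0 : (0 < #|A|%:R ^+ r :> R).
  case: (r) rA rm => [|r']; first by rewrite expr0.
  by move=> _ h0; rewrite exprn_gt0 // ltr0n (leq_trans _ h0).
rewrite ler_pdivlMr // -natrX -!natrM ler_nat.
apply: leq_trans (leq_mul (card_perm_on_map _ _ uw) (leqnn _)) _.
rewrite -(ffact_fact rm) [leqLHS]mulnC [leqRHS]mulnA leq_mul2r.
by rewrite expn_le_ffact // orbT.
Qed.

(** Given that the images of [w] avoid [B], a further point hits [B] with probability at least
    [|B| / |T|]. *)
Lemma card_perm_avoid B w : uniq w -> (0 < #|T|)%N ->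
  #|[set p : {perm T} | all (fun x => p x \notin B) w]|%:R <=
    (#|T|)`!%:R * (1 - #|B|%:R / #|T|%:R) ^+ size w :> R.
Proof.
move=> uw T0; elim: w uw => [|x w IH] /=.
  move=> _; rewrite expr0 mulr1 ler_nat.
  have -> : ((#|T|)`! = #|perm_on [set: T]|)%N by rewrite card_perm cardsT.
  by apply: subset_leq_card; apply/fintype.subsetP => p _; apply/fintype.subsetP.
case/andP => xw uw; have {}IH := IH uw.
set P := [set p : {perm T} | all _ w] in IH *.
pose N y := #|[set p in P | p y \in B]|.
(* Points of [w] never hit [B] here; for any other [y], exchanging [x] and [y] shows that [x] hits
   [B] as often. *)
have Nx y : (N y <= N x)%N.
  case: (boolP (y \in w)) => yw.
    rewrite /N; apply: leq_trans (leq0n _); rewrite leqn0 cards_eq0.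
    apply/eqP/setP => p; rewrite !inE; apply/negbTE; apply/negP => /andP[/allP h].
    by apply/negP; apply: h.
  rewrite /N -(card_imset _ (mulgI (tperm x y))%g).
  apply: subset_leq_card; apply/fintype.subsetP => q /imsetP[p].
  rewrite !inE => /andP[/allP h yB] ->; rewrite permM tpermL yB andbT.
  apply/allP => z zw /=; rewrite permM tpermD; first exact: h.
    by apply: contraNneq xw => ->.
  by apply: contraNneq yw => ->.
(* Each permutation hits [B] at exactly [|B|] points. *)
have EN : (\sum_y N y = #|B| * #|P|)%N.
  transitivity (\sum_(p in P) \sum_y (p y \in B))%N.
    rewrite exchange_big; apply: eq_bigr => y _ /=.
    rewrite /N -sum1_card big_mkcond [RHS]big_mkcond; apply: eq_bigr => p _ /=.
    by rewrite inE; case: (p \in P); case: (p y \in B).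
  rewrite mulnC -sum_nat_const; apply: eq_bigr => p _.
  rewrite -(reindex_inj (@perm_inj _ p) (P := predT) (F := fun y => (y \in B) : nat)) /=.
  by rewrite -sum1_card [RHS]big_mkcond; apply: eq_bigr => y _; case: (y \in B).
have le1 : (#|B| * #|P| <= #|T| * N x)%N.
  by rewrite -EN -sum_nat_const; apply: leq_sum => y _.
have -> : [set p : {perm T} | (p x \notin B) && all (fun x0 => p x0 \notin B) w]
   = P :\: [set p in P | p x \in B].
  by apply/setP => p; rewrite !inE; case: (p x \in B); case: all.
have cP : (#|P :\: [set p in P | p x \in B]| + N x = #|P|)%N.
  rewrite /N -(cardsID [set p in P | p x \in B] P) addnC; congr (_ + _)%N.
  by apply: eq_card => p; rewrite !inE; case: all.
set c := #|_ :\: _| in cP *.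
have T0' : 0 < #|T|%:R :> R by rewrite ltr0n.
have B1 : 0 <= 1 - #|B|%:R / #|T|%:R :> R.
  by rewrite subr_ge0 ler_pdivrMr // mul1r ler_nat max_card.
rewrite exprS mulrCA.
apply: (@le_trans _ _ ((1 - #|B|%:R / #|T|%:R) * #|P|%:R)); last exact: ler_wpM2l.
have : #|B|%:R / #|T|%:R * #|P|%:R <= (N x)%:R :> R.
  by rewrite mulrAC ler_pdivrMr // -!natrM ler_nat [leqRHS]mulnC.
have : #|P|%:R = c%:R + (N x)%:R :> R by rewrite -natrD cP.
lra.
Qed.

End RandomPermutations.

(** * Expected walk of a block with independently sampled endpoints *)

Section ExpectedWalk.
Set Implicit Arguments.
Unset Strict Implicit.
Variables (R : realType) (T : finType) (a b : T -> R) (IA IB : {set T}).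
Variables (va vb : seq R).
Hypotheses (ua : uniq va) (ub : uniq vb) (sa : (1 < size va)%N) (sb : (1 < size vb)%N).
Hypothesis unifa : forall h : R -> R,
  \sum_x unif R IA x * h (a x) = (\sum_(v <- va) h v) / (size va)%:R.
Hypothesis unifb : forall h : R -> R,
  \sum_x unif R IB x * h (b x) = (\sum_(v <- vb) h v) / (size vb)%:R.

Fixpoint products (s t : seq T) : seq R :=
  match s, t with
  | x :: y :: s', x' :: y' :: t' => (a x - a y) * (b x' - b y') :: products s' t'
  | _, _ => [::]
  end.

Local Notation kernel := (T -> R).
Implicit Type ks : seq (kernel * kernel).

(** In each pair of endpoints only the first is known to lie in the chosen set, hence to be uniform
    there; the second gets an arbitrary law. *)
Definition kernelsA ks := flatten [seq [:: unif R IA; k.1] | k <- ks].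
Definition kernelsB ks := flatten [seq [:: unif R IB; k.2] | k <- ks].
Definition expect2 ks (Phi : seq R -> R) : R :=
  expect (kernelsA ks) (fun s => expect (kernelsB ks) (fun t => Phi (products s t))).

(** With [y] and [y'] outermost, the inner average runs over shifts [(a - al) * (b - be)] with [al],
    [be] fixed, as in [acf_product_shifts]. *)
Lemma expect2_cons k ks Phi : expect2 (k :: ks) Phi =
  \sum_y k.1 y * \sum_y' k.2 y' * \sum_x unif R IA x * \sum_x' unif R IB x' *
    expect2 ks (fun cs => Phi ((a x - a y) * (b x' - b y') :: cs)).
Proof.
rewrite {1}/expect2 /=.
transitivity (\sum_x \sum_y \sum_x' \sum_y' unif R IA x * k.1 y * unif R IB x' * k.2 y' *
    expect2 ks (fun cs => Phi ((a x - a y) * (b x' - b y') :: cs))).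
  apply: eq_bigr => x _; rewrite mulr_sumr; apply: eq_bigr => y _.
  rewrite (expect_sum (unif R IB) (fun x' s => \sum_y' k.2 y' * expect (kernelsB ks)
      (fun t => Phi ((a x - a y) * (b x' - b y') :: products s t)))).
  rewrite !mulr_sumr; apply: eq_bigr => x' _.
  rewrite (expect_sum k.2 (fun y' s => expect (kernelsB ks)
      (fun t => Phi ((a x - a y) * (b x' - b y') :: products s t)))).
  by rewrite !mulr_sumr; apply: eq_bigr => y' _; rewrite /expect2; ring.
rewrite exchange_big /=; apply: eq_bigr => y _.
transitivity (\sum_y' \sum_x \sum_x' unif R IA x * k.1 y * unif R IB x' * k.2 y' *
    expect2 ks (fun cs => Phi ((a x - a y) * (b x' - b y') :: cs))).
  by rewrite [RHS]exchange_big; apply: eq_bigr => x _; rewrite exchange_big.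
rewrite mulr_sumr; apply: eq_bigr => y' _; rewrite !mulr_sumr; apply: eq_bigr => x _.
by rewrite !mulr_sumr; apply: eq_bigr => x' _; ring.
Qed.

Fixpoint kernels_stoch ks : Prop :=
  if ks is k :: ks' then [/\ stochastic k.1, stochastic k.2 & kernels_stoch ks'] else True.

Lemma expect2_walk_cons k ks z :
  expect2 (k :: ks) (fun cs => walk cs z) =
  \sum_y k.1 y * \sum_y' k.2 y' * \sum_x unif R IA x * \sum_x' unif R IB x' *
   autocorr [:: 0; (a x - a y) * (b x' - b y')] (fun z => expect2 ks (fun cs => walk cs z)) z.
Proof.
rewrite expect2_cons; apply: eq_bigr => y _; congr (_ * _); apply: eq_bigr => y' _.
congr (_ * _); apply: eq_bigr => x _; congr (_ * _); apply: eq_bigr => x' _.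
congr (_ * _); set c := (_ * _); rewrite autocorr_pair.
have walkE cs : walk (c :: cs) z =
    4^-1 * (2 * walk cs z) + 4^-1 * (walk cs (z + c) + walk cs (z - c)).
  by rewrite walk_cons autocorr_pair; lra.
have D F G : expect2 ks (fun cs => F cs + G cs) = expect2 ks F + expect2 ks G.
  rewrite /expect2 -expectD; apply: eq_expect => s; rewrite -expectD.
  exact: eq_expect.
have Z (u : R) F : expect2 ks (fun cs => u * F cs) = u * expect2 ks F.
  rewrite /expect2 -expectZ; apply: eq_expect => s; rewrite -expectZ.
  exact: eq_expect.
have -> : expect2 ks (fun cs => walk (c :: cs) z) =
   expect2 ks (fun cs => 4^-1 * (2 * walk cs z) + 4^-1 * (walk cs (z + c) + walk cs (z - c))).
  by rewrite /expect2; apply: eq_expect => s; apply: eq_expect => t.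
by rewrite D !Z D; lra.
Qed.

Hypotheses (IA0 : (0 < #|IA|)%N) (IB0 : (0 < #|IB|)%N).

Lemma eq_acf (f g : R -> R) : f =1 g -> acf g -> acf f.
Proof. by move/boolp.funext => ->. Qed.

Lemma acf_expect2_walk ks : kernels_stoch ks ->
  acf (fun z => expect2 ks (fun cs => walk cs z)).
Proof.
elim: ks => [|k ks IH] /=; first by move=> _; exact: acf_walk.
move=> [[p10 p11] [p20 p21] /IH aF].
have [ua0 ua1] := unif_stochastic R IA0; have [ub0 ub1] := unif_stochastic R IB0.
pose G y y' x x' z := autocorr [:: 0; (a x - a y) * (b x' - b y')]
  (fun z => expect2 ks (fun cs => walk cs z)) z.
have aG y y' x x' : acf (G y y' x x') by exact: acf_autocorr.
have aX y y' x := acf_avg ub0 ub1 (aG y y' x).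
have aY y y' := acf_avg ua0 ua1 (aX y y').
have aY' y := acf_avg p20 p21 (aY y).
apply: eq_acf (acf_avg p10 p11 aY') => z; exact: expect2_walk_cons.
Qed.

Lemma sum_avg_le (I : finType) (w : I -> R) (h : I -> R) (C : R) :
  (forall i, 0 <= w i) -> \sum_i w i = 1 -> (forall i, h i <= C) ->
  \sum_i w i * h i <= C.
Proof.
move=> w0 w1 hC; rewrite -[C]mul1r -w1 mulr_suml; apply: ler_sum => i _.
exact: ler_wpM2l.
Qed.

(** A step by [c] lowers the value at 0 by [(f 0 - f c) / 2], on average at least [f 0 / 16000] by
    [acf_product_shifts]. The lower bound passes to the shorter list because further increments only
    decrease the walk. *)
Lemma expect2_walk_0 ks : kernels_stoch ks ->
  9 < expect2 ks (fun cs => walk cs 0) * ((size va)%:R * (size vb)%:R) ->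
  expect2 ks (fun cs => walk cs 0) <= (1 - 16000^-1) ^+ size ks.
Proof.
have [c c0 cE] : exists2 c : R, 0 <= c & c = 1 - 16000^-1.
  by eexists; last reflexivity; lra.
rewrite -cE.
elim: ks => [|k ks IH] /=.
  by move=> _ _; rewrite expr0 /expect2 /=; exact: walk_0_le1.
move=> [[p10 p11] [p20 p21] pks]; have aF := acf_expect2_walk pks.
have [ua0 ua1] := unif_stochastic R IA0; have [ub0 ub1] := unif_stochastic R IB0.
set F := (fun z => expect2 ks (fun cs => walk cs z)) in aF.
set k' : R := (size va)%:R in IH *; set l' : R := (size vb)%:R in IH *.
have k0 : 0 < k' by rewrite ltr0n (leq_trans _ sa).
have l0 : 0 < l' by rewrite ltr0n (leq_trans _ sb).
have le1 : expect2 (k :: ks) (fun cs => walk cs 0) <= F 0.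
  rewrite expect2_walk_cons.
  apply: sum_avg_le => // y; apply: sum_avg_le => // y'.
  apply: sum_avg_le => // x; apply: sum_avg_le => // x'.
  exact: autocorr_0_le.
move=> big.
have bigF : 9 < F 0 * (k' * l').
  by apply: lt_le_trans big _; rewrite ler_pM2r // mulr_gt0.
have {}IH := IH pks bigF.
rewrite exprS; apply: (@le_trans _ _ (c * F 0)); last exact: ler_wpM2l.
rewrite expect2_walk_cons.
apply: sum_avg_le => // y; apply: sum_avg_le => // y'.
under eq_bigr => x _ do rewrite (unifb (fun v => autocorr [:: 0; (a x - a y) * (v - b y')] F 0)).
rewrite (unifa (fun u => (\sum_(v <- vb) autocorr [:: 0; (u - a y) * (v - b y')] F 0) / _)).
rewrite -mulr_suml -mulrA -invfM ler_pdivrMr; last by rewrite mulr_gt0.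
have := acf_product_shifts (a y) (b y') aF ua ub sa sb bigF.
rewrite -/k' -/l'.
have -> : \sum_(i <- va) \sum_(v <- vb) autocorr [:: 0; (i - a y) * (v - b y')] F 0 =
  F 0 * (k' * l') - 2^-1 * \sum_(u <- va) \sum_(v <- vb) (F 0 - F ((u - a y) * (v - b y'))).
  have -> : F 0 * (k' * l') = \sum_(u <- va) \sum_(v <- vb) F 0.
    by rewrite !big_const_seq !count_predT !iter_addr_0 mulrA mulrAC !mulr_natr.
  rewrite mulr_sumr -sumrB; apply: eq_bigr => u _.
  rewrite mulr_sumr -sumrB; apply: eq_bigr => v _.
  rewrite autocorr_pair add0r sub0r (acf_even aF); lra.
by rewrite [l' * k']mulrC cE; lra.
Qed.

Lemma avg_neq_ge_half (v : seq R) (y : R) : uniq v -> (1 < size v)%N ->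
  2^-1 <= (\sum_(u <- v) (u != y)%:R) / (size v)%:R :> R.
Proof.
move=> uv sv; have s2 : 2 <= (size v)%:R :> R by rewrite ler_nat.
rewrite ler_pdivlMr; last by lra.
have -> : \sum_(u <- v) (u != y)%:R = (size v)%:R - (y \in v)%:R :> R.
  rewrite -(sum_eq_uniq R y uv).
  have -> : (size v)%:R = \sum_(u <- v) 1 :> R.
    by rewrite big_const_seq count_predT iter_addr_0.
  by rewrite -sumrB; apply: eq_bigr => u _; case: (u == y); rewrite ?subr0 ?subrr.
have : (y \in v)%:R <= 1 :> R by rewrite lern1 leq_b1.
lra.
Qed.

(** Each of the two factors of an increment is nonzero with probability at least 1/2, whatever the
    second endpoints, so the product vanishes with probability at most 3/4. *)
Lemma expect2_all0 ks : kernels_stoch ks ->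
  0 <= expect2 ks (fun cs => (all (pred1 0) cs)%:R) <= (3 / 4) ^+ size ks.
Proof.
elim: ks => [|k ks IH] /=; first by move=> _; rewrite /expect2 /= expr0 ler01 lexx.
move=> [[p10 p11] [p20 p21] /IH {}IH].
have [ua0 ua1] := unif_stochastic R IA0; have [ub0 ub1] := unif_stochastic R IB0.
rewrite expect2_cons exprS.
set E := expect2 ks (fun cs => (all (pred1 0) cs)%:R) in IH *.
have {IH}/andP[E0 IH] := IH.
have cE c : expect2 ks (fun cs => (all (pred1 0) (c :: cs))%:R) = (c == 0)%:R * E.
  rewrite /E /expect2 -expectZ; apply: eq_expect => s; rewrite -expectZ.
  by apply: eq_expect => t /=; rewrite -mulnb natrM.
apply/andP; split.
  do 4!(apply: sumr_ge0 => ? _; apply: mulr_ge0 => //).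
  by rewrite cE mulr_ge0 ?ler0n.
apply: sum_avg_le => // y; apply: sum_avg_le => // y'.
set p := (\sum_(u <- va) (u != a y)%:R) / (size va)%:R : R.
set q := (\sum_(u <- vb) (u != b y')%:R) / (size vb)%:R : R.
have p2 : 2^-1 <= p by exact: avg_neq_ge_half.
have q2 : 2^-1 <= q by exact: avg_neq_ge_half.
have Ep : \sum_x unif R IA x * (a x != a y)%:R = p.
  exact: (unifa (fun u => (u != a y)%:R)).
have Eq : \sum_x unif R IB x * (b x != b y')%:R = q.
  exact: (unifb (fun u => (u != b y')%:R)).
have -> : \sum_x unif R IA x * \sum_x' unif R IB x' *
    expect2 ks (fun cs => (all (pred1 0) ((a x - a y) * (b x' - b y') :: cs))%:R)
  = \sum_x unif R IA x * ((1 - (a x != a y)%:R * q) * E).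
  apply: eq_bigr => x _; congr (_ * _).
  rewrite -Eq -[X in (X - _) * E]ub1 mulr_sumr -sumrB mulr_suml.
  apply: eq_bigr => x' _; rewrite cE mulf_eq0 !subr_eq0.
  by case: (a x == a y); case: (b x' == b y') => /=; ring.
have -> : \sum_x unif R IA x * ((1 - (a x != a y)%:R * q) * E) = (1 - p * q) * E.
  rewrite -Ep -[X in (X - _) * E]ua1 mulr_suml -sumrB mulr_suml.
  by apply: eq_bigr => x _; ring.
have pq : 2^-1 * 2^-1 <= p * q by apply: ler_pM.
apply: (@le_trans _ _ (3 / 4 * E)); first by apply: ler_wpM2r => //; lra.
by apply: ler_wpM2l => //; lra.
Qed.

End ExpectedWalk.

(** * Random swaps *)

Section Swaps.
Set Implicit Arguments.
Unset Strict Implicit.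
Variables (R : realType) (n : nat) (a b : 'I_n -> R).
Implicit Types (p : 'S_n) (ws : seq ('I_n * 'I_n)).

Definition endpoints ws := flatten [seq [:: w.1; w.2] | w <- ws].

Fixpoint swaps ws : seq 'S_n :=
  if ws is w :: ws' then swaps ws' ++ [seq (tperm w.1 w.2 * s)%g | s <- swaps ws']
  else [:: 1%g].

Lemma swaps_out ws s x : s \in swaps ws -> x \notin endpoints ws -> s x = x.
Proof.
elim: ws s => [|w ws IH] s /=.
  by rewrite inE => /eqP -> _; rewrite perm1.
rewrite mem_cat !inE !negb_or => sS /and3P[x1 x2 xE].
case/orP: sS => [sS|/mapP[s' sS ->]]; first exact: IH.
by rewrite permM tpermD ?(IH s') // eq_sym.
Qed.

Lemma permsum_tperm p i j : i != j ->
  permsum a b (tperm i j * p)%g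
    = permsum a b p - (a i - a j) * (b (p i) - b (p j)).
Proof.
move=> ij; have ji : j != i by rewrite eq_sym.
rewrite /permsum (bigD1 i) // (bigD1 j) //= [in RHS](bigD1 i) // [in RHS](bigD1 j) //=.
rewrite !permM tpermL tpermR.
rewrite (eq_bigr (fun k => a k * b (p k))); first by ring.
by move=> k /andP[ki kj]; rewrite permM tpermD // eq_sym.
Qed.

Definition increments ws p : seq R :=
  [seq (a w.1 - a w.2) * (b (p w.1) - b (p w.2)) | w <- ws].

(** As the pairs are disjoint, the increment of a swap does not depend on the other swaps. *)
Lemma permsum_swaps ws p : uniq (endpoints ws) ->
  [seq permsum a b (s * p)%g | s <- swaps ws]
    = [seq permsum a b p - y | y <- subsums (increments ws p)].
Proof.
elim: ws => [|w ws IH] /=; first by rewrite mul1g subr0.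
move=> /and3P[]; rewrite inE negb_or => /andP[w12 w1] w2 uw.
have {}IH := IH uw.
rewrite map_cat IH /sadd /= cats0 map_cat; congr (_ ++ _).
  by rewrite -map_comp; apply: eq_map => y /=; rewrite add0r.
set c := _ * _.
transitivity [seq x - c | x <- [seq permsum a b (s * p)%g | s <- swaps ws]].
  rewrite -!map_comp; apply/eq_in_map => s sS /=.
  by rewrite -mulgA permsum_tperm // !permM !(swaps_out sS).
by rewrite IH -!map_comp; apply: eq_map => y /=; rewrite opprD addrA addrAC.
Qed.

(** For every product [s] of swaps, [s * p] is as uniform as [p]. For fixed [p], the average over
    [s] is the concentration of a signed sum, split into two halves. *)
Lemma walk_le_swaps ws1 ws2 x : uniq (endpoints (ws1 ++ ws2)) ->
  n`!%:R * probeq a b x <=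
  \sum_p 2^-1 * (walk (increments ws1 p) 0 + walk (increments ws2 p) 0).
Proof.
move=> uw; set ws := ws1 ++ ws2 in uw.
rewrite /probeq mulrCA divff ?mulr1 ?pnatr_eq0 -?lt0n ?fact_gt0 //.
set N := size (swaps ws).
have N0 : 0 < N%:R :> R.
  rewrite ltr0n /N; elim: (ws) => //= w ws' IH.
  by rewrite size_cat addn_gt0 IH.
have sN p : size (subsums (increments ws p)) = N.
  by rewrite -(size_map (fun y => permsum a b p - y)) -permsum_swaps // size_map.
have EN : #|[set p | permsum a b p == x]|%:R * N%:R =
    \sum_p \sum_(s <- swaps ws) (permsum a b (s * p)%g == x)%:R :> R.
  rewrite exchange_big /=.
  rewrite (eq_bigr (fun=> #|[set p | permsum a b p == x]|%:R)); last first.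
    move=> s _; rewrite (reindex_inj (mulgI s^-1%g)) /=.
    under eq_bigr => p _ do rewrite mulKVg.
    rewrite -sum1_card natr_sum [RHS]big_mkcond; apply: eq_bigr => p _ /=.
    by rewrite inE; case: eqP.
  by rewrite big_const_seq count_predT iter_addr_0 mulr_natr.
rewrite -(ler_pM2r N0) EN mulr_suml; apply: ler_sum => p _.
have -> : \sum_(s <- swaps ws) (permsum a b (s * p)%g == x)%:R =
    (count_mem (permsum a b p - x) (subsums (increments ws p)))%:R :> R.
  rewrite -(big_map (fun s => permsum a b (s * p)%g) predT (fun z => (z == x)%:R)) /=.
  rewrite permsum_swaps // big_map -sum1_count natr_sum [RHS]big_mkcond /=.
  apply: eq_bigr => y _.
  have -> : (permsum a b p - y == x) = (y == permsum a b p - x).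
    by rewrite subr_eq [RHS]eq_sym subr_eq addrC.
  by case: eqP.
rewrite -ler_pdivrMr // -(sN p) /increments map_cat.
exact: subsums_cat_conc.
Qed.

(** Allows the coefficients [a] to be shuffled by a random permutation of [IA] at no cost. *)
Lemma probeq_reindex (r : 'S_n) x : probeq (a \o r) b x = probeq a b x.
Proof.
rewrite /probeq; congr (_%:R / _).
rewrite -(card_imset _ (mulgI r^-1%g)); apply: eq_card => p.
rewrite !inE; apply/imsetP/idP => [[q]|/eqP px].
  rewrite inE => /eqP <- ->; apply/eqP.
  rewrite /permsum (reindex_inj (@perm_inj _ r)) /=; apply: eq_bigr => i _.
  by rewrite permM permK.
exists (r * p)%g; last by rewrite mulKg.
rewrite inE -px; apply/eqP.
rewrite /permsum [RHS](reindex_inj (@perm_inj _ r)) /=; apply: eq_bigr => i _.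
by rewrite permM.
Qed.

End Swaps.

(** * Choice of useful swaps and comparison with independent samples *)

Section Chosen.
Set Implicit Arguments.
Unset Strict Implicit.
Lemma mem_subseq_flatten (T : eqType) (s : seq T) (ss : seq (seq T)) :
  s \in ss -> subseq s (flatten ss).
Proof.
elim: ss => //= t ss IH; rewrite inE => /orP[/eqP ->|/IH h].
  exact: prefix_subseq.
by apply: subseq_trans h _; exact: suffix_subseq.
Qed.

Variables (R : realType) (n : nat) (a b : 'I_n -> R) (IA IB : {set 'I_n}).
Implicit Types (p r : 'S_n) (ws : seq ('I_n * 'I_n)) (bl : seq (seq ('I_n * 'I_n))).

(* The choice depends on [p] only through membership in [IB], hence survives the
   composition of [p] with a random permutation of [IB]. *)
Definition chosen p bl :=
  flatten [seq take 1 [seq w <- ws | p w.1 \in IB] | ws <- bl].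

Lemma chosen_subseq p bl : subseq (chosen p bl) (flatten bl).
Proof.
elim: bl => //= ws bl IH; apply: cat_subseq => //.
exact: subseq_trans (take_subseq _ _) (filter_subseq _ _).
Qed.

Lemma chosen_perm_on p k bl : perm_on IB k -> chosen (p * k)%g bl = chosen p bl.
Proof.
move=> kB; rewrite /chosen; congr flatten; apply: eq_map => ws; congr take.
by apply: eq_filter => w; rewrite permM perm_closed.
Qed.

Definition complete p bl := all (fun ws => has (fun w => p w.1 \in IB) ws) bl.

Lemma complete_perm_on p k bl : perm_on IB k -> complete (p * k)%g bl = complete p bl.
Proof.
move=> kB; apply: eq_all => ws; apply: eq_has => w; by rewrite permM perm_closed.
Qed.

Lemma size_chosen p bl : complete p bl -> size (chosen p bl) = size bl.
Proof.
elim: bl => //= ws bl IH /andP[h /IH E]; rewrite size_cat E.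
by move: h; rewrite has_filter; case: [seq _ <- _ | _] => //= w l _; rewrite take0.
Qed.

Lemma chosen_in p bl w : w \in chosen p bl -> p w.1 \in IB.
Proof.
move=> /flatten_mapP[ws _ /mem_take]; by rewrite mem_filter => /andP[].
Qed.

Lemma subseq_endpoints ws1 ws2 : subseq ws1 ws2 ->
  subseq (endpoints ws1) (endpoints ws2).
Proof.
elim: ws2 ws1 => [|w ws2 IH] [|w1 ws1] //; rewrite [X in X -> _]/=.
case: eqP => [->|_] h; first by rewrite /= !eqxx; exact: IH.
apply: subseq_trans (IH _ h) _; exact: (@suffix_subseq _ [:: w.1; w.2]).
Qed.

Lemma size_endpoints ws : size (endpoints ws) = (2 * size ws)%N.
Proof. by elim: ws => //= w ws ->; rewrite mulnS. Qed.

Lemma increments_products r p ws : increments (a \o r) b ws p =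
  products a b (map r (endpoints ws)) (map p (endpoints ws)).
Proof. by elim: ws => //= w ws <-. Qed.

Variables (bl : seq (seq ('I_n * 'I_n))) (s : nat) (Phi : seq R -> R) (e : R).
Hypothesis e0 : 0 <= e.
Hypotheses (Phi_ge0 : forall cs, 0 <= Phi cs) (Phi_le1 : forall cs, Phi cs <= 1).
Hypothesis ubl : uniq (endpoints (flatten bl)).
Hypothesis sbl : forall ws, ws \in bl -> size ws = s.
Hypothesis blA : forall w, w \in flatten bl -> w.1 \in IA.
Hypotheses (bigA : (2 * (2 * size bl) ^ 2 <= #|IA|)%N)
           (bigB : (2 * (2 * size bl) ^ 2 <= #|IB|)%N).
Hypotheses (IA0 : (0 < #|IA|)%N) (IB0 : (0 < #|IB|)%N).
Hypothesis Ee : forall ks : seq (('I_n -> R) * ('I_n -> R)),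
  kernels_stoch ks -> size ks = size bl -> expect2 a b IA IB ks Phi <= e.

(** A union bound over the lists of the block: each consists of [s] pairs with distinct first
    points, all of which must miss [IB]. *)
Lemma card_incomplete :
  #|[set p | ~~ complete p bl]|%:R <=
   n`!%:R * ((size bl)%:R * (1 - #|IB|%:R / n%:R) ^+ s) :> R.
Proof.
have n0 : (0 < n)%N by rewrite -(card_ord n) (leq_trans IB0) // max_card.
pose bad ws := #|[set p : 'S_n | all (fun x => p x \notin IB) [seq w.1 | w <- ws]]|.
apply: (@le_trans _ _ (\sum_(ws <- bl) bad ws)%:R).
  rewrite ler_nat; elim: (bl) => [|ws l IH] /=.
    by rewrite big_nil leqn0 cards_eq0; apply/eqP/setP => p; rewrite !inE.
  rewrite big_cons; apply: leq_trans (leq_add (leqnn _) IH).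
  rewrite /bad; apply: leq_trans (leq_card_setU _ _).
  apply: subset_leq_card; apply/fintype.subsetP => p; rewrite !inE /= negb_and.
  by rewrite -all_predC all_map.
rewrite natr_sum mulrCA.
apply: (@le_trans _ _ (\sum_(ws <- bl) n`!%:R * (1 - #|IB|%:R / n%:R) ^+ s)); last first.
  by rewrite big_const_seq count_predT iter_addr_0 -[_ *+ size bl]mulr_natl.
rewrite big_seq [leRHS]big_seq; apply: ler_sum => ws wsb.
have uws : uniq [seq w.1 | w <- ws].
  move: (mem_subseq_flatten wsb).
  move/subseq_endpoints/subseq_uniq/(_ ubl) => {wsb}.
  elim: ws => //= w ws IH /and3P[]; rewrite inE negb_or => /andP[_ w1] _ /IH ->.
  rewrite andbT; apply: contra w1 => /mapP[w' w'ws ->].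
  by apply/flatten_mapP; exists w' => //; rewrite mem_head.
have := card_perm_avoid R IB uws; rewrite card_ord => /(_ n0).
by rewrite size_map sbl.
Qed.

Lemma expect_kernelsB_ge0 ks (F : seq 'I_n -> R) : kernels_stoch ks ->
  (forall t, 0 <= F t) -> 0 <= expect (kernelsB IB ks) F.
Proof.
elim: ks F => [|k ks IH] F //= [_ [k0 _] pks] F0.
have [u0 _] := unif_stochastic R IB0.
apply: sumr_ge0 => x _; apply: mulr_ge0 => //; apply: sumr_ge0 => y _.
by apply: mulr_ge0 => //; apply: IH.
Qed.

(** For fixed [p] the chosen pairs are fixed, and only [r] and [k] are random. Replacing the images
    of the endpoints by independent samples costs a factor 2 on each side. *)
Lemma chosen_expect_le p : complete p bl ->
  \sum_(r | perm_on IA r) \sum_(k | perm_on IB k)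
     Phi (increments (a \o r) b (chosen p bl) (p * k)%g)
  <= (#|IA|)`!%:R * (#|IB|)`!%:R * (4 * e).
Proof.
move=> cp; set ws := chosen p bl.
have sws : size ws = size bl by exact: size_chosen.
have uw : uniq (endpoints ws).
  exact: subseq_uniq (subseq_endpoints (chosen_subseq p bl)) ubl.
have upw : uniq (map p (endpoints ws)) by rewrite map_inj_uniq //; exact: perm_inj.
(* A second endpoint is resampled if it too lies in the set, and stays fixed otherwise. *)
pose ks := [seq (kern R IA w.2, kern R IB (p w.2)) | w <- ws].
have pks : kernels_stoch ks.
  rewrite /ks; elim: (ws) => //= w l IH; split=> //; exact: kern_stochastic.
have EA : map (kern R IA) (endpoints ws) = kernelsA IA ks.
  have : {in ws, forall w, w.1 \in IA}.
    by move=> w /(mem_subseq (chosen_subseq p bl)); exact: blA.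
  rewrite /ks; elim: (ws) => //= w l IH h; rewrite IH.
    by rewrite {1}/kern h ?mem_head.
  by move=> w' w'l; apply: h; rewrite inE w'l orbT.
have EB : map (kern R IB) (map p (endpoints ws)) = kernelsB IB ks.
  have : {in ws, forall w, p w.1 \in IB} by move=> w /chosen_in.
  rewrite /ks; elim: (ws) => //= w l IH h; rewrite IH.
    by rewrite {1}/kern h ?mem_head.
  by move=> w' w'l; apply: h; rewrite inE w'l orbT.
pose G t u := Phi (products a b t u).
have fB : 0 <= 2 * (#|IB|)`!%:R :> R by rewrite mulr_ge0 ?ler0n.
have fA : 0 <= 2 * (#|IA|)`!%:R :> R by rewrite mulr_ge0 ?ler0n.
apply: (@le_trans _ _ (\sum_(r | perm_on IA r) 2 * (#|IB|)`!%:R *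
    expect (kernelsB IB ks) (G (map r (endpoints ws))))).
  apply: ler_sum => r rA; rewrite -EB.
  have := @perm_on_expect R _ IB _ (G (map r (endpoints ws))) upw.
  rewrite size_map size_endpoints sws => /(_ (fun=> Phi_ge0 _) bigB).
  apply: le_trans; apply: ler_sum => k _.
  rewrite increments_products /G -map_comp.
  by rewrite (eq_map (permM p k)).
rewrite -mulr_sumr.
have := @perm_on_expect R _ IA _ (fun t => expect (kernelsB IB ks) (G t)) uw.
rewrite size_endpoints sws EA => /(_ _ bigA) H.
have He : expect2 a b IA IB ks Phi <= e by apply: Ee => //; rewrite /ks size_map sws.
have G0 t : 0 <= expect (kernelsB IB ks) (G t).
  by apply: expect_kernelsB_ge0 => // u; exact: Phi_ge0.
apply: le_trans (ler_wpM2l fB (le_trans (H G0) (ler_wpM2l fA He))) _.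
lra.
Qed.

(** Incomplete [p] are counted with the trivial bound [Phi <= 1]; complete ones are averaged over
    permutations of [IB]. *)
Lemma block_expect :
  \sum_(r | perm_on IA r) \sum_p Phi (increments (a \o r) b (chosen p bl) p)
   <= (#|IA|)`!%:R * n`!%:R *
      ((size bl)%:R * (1 - #|IB|%:R / n%:R) ^+ s + 4 * e).
Proof.
set Q := (size bl)%:R * _.
have fB0 : 0 < (#|IB|)`!%:R :> R by rewrite ltr0n fact_gt0.
have fA0 : 0 < (#|IA|)`!%:R :> R by rewrite ltr0n fact_gt0.
pose g r p := Phi (increments (a \o r) b (chosen p bl) p).
have sA (x : R) : \sum_(r : 'S_n | perm_on IA r) x = (#|IA|)`!%:R * x.
  by rewrite sumr_const -card_perm mulr_natl.
have sB (x : R) : \sum_(r : 'S_n | perm_on IB r) x = (#|IB|)`!%:R * x.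
  by rewrite sumr_const -card_perm mulr_natl.
have H1 : \sum_(r | perm_on IA r) \sum_(p | ~~ complete p bl) g r p
    <= (#|IA|)`!%:R * (n`!%:R * Q).
  rewrite -sA; apply: ler_sum => r _; apply: le_trans card_incomplete.
  rewrite -sum1_card natr_sum big_mkcond [leRHS]big_mkcond; apply: ler_sum => p _ /=.
  by rewrite inE; case: ifP => // _; exact: Phi_le1.
have H2 : \sum_(r | perm_on IA r) \sum_(p | complete p bl) g r p
    <= (#|IA|)`!%:R * (n`!%:R * (4 * e)).
  rewrite -(ler_pM2l fB0) -sB.
  (* Right multiplication by [k] permutes the complete [p] and leaves the chosen pairs unchanged. *)
  have -> : \sum_(k | perm_on IB k) \sum_(r | perm_on IA r) \sum_(p | complete p bl) g r p
    = \sum_(p | complete p bl) \sum_(r | perm_on IA r) \sum_(k | perm_on IB k)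
        Phi (increments (a \o r) b (chosen p bl) (p * k)%g).
    transitivity (\sum_(k | perm_on IB k) \sum_(r | perm_on IA r) \sum_(p | complete p bl)
       Phi (increments (a \o r) b (chosen p bl) (p * k)%g)).
      apply: eq_bigr => k kB; apply: eq_bigr => r _.
      rewrite (reindex_inj (mulIg k)) /=.
      apply: eq_big => [p|p _]; first by rewrite complete_perm_on.
      by rewrite /g chosen_perm_on.
    rewrite [RHS]exchange_big [LHS]exchange_big /=; apply: eq_bigr => r _.
    by rewrite [RHS]exchange_big.
  apply: (@le_trans _ _ (\sum_(p : 'S_n | complete p bl)
      (#|IA|)`!%:R * (#|IB|)`!%:R * (4 * e))).
    by apply: ler_sum => p cp; apply: chosen_expect_le.
  have E0 : 0 <= (#|IA|)`!%:R * (#|IB|)`!%:R * (4 * e).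
    by rewrite !mulr_ge0 ?ler0n.
  apply: (@le_trans _ _ (\sum_(p : 'S_n) (#|IA|)`!%:R * (#|IB|)`!%:R * (4 * e))).
    by rewrite big_mkcond; apply: ler_sum => p _; case: ifP.
  by rewrite sumr_const card_Sn -[_ *+ n`!]mulr_natl; lra.
apply: le_trans (_ : _ <= (#|IA|)`!%:R * (n`!%:R * Q) + (#|IA|)`!%:R * (n`!%:R * (4 * e))) _; last by lra.
apply: le_trans (lerD H1 H2); rewrite -big_split; apply: ler_sum => r _ /=.
by rewrite (bigID (fun p => complete p bl)) /= addrC.
Qed.

End Chosen.

(** * Concentration bound from many blocks of swaps *)

Section Blocks.
Set Implicit Arguments.
Unset Strict Implicit.

Fixpoint pairup (T : Type) (s : seq T) : seq (T * T) :=
  if s is x :: y :: s' then (x, y) :: pairup s' else [::].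

Lemma pairup_ind (T : Type) (P : seq T -> Prop) :
  P [::] -> (forall x, P [:: x]) -> (forall x y s, P s -> P (x :: y :: s)) ->
  forall s, P s.
Proof.
move=> P0 P1 P2 s; suff : P s /\ forall x, P (x :: s) by case.
by elim: s => [|y s [IH1 IH2]]; split=> // x; apply: P2.
Qed.

Lemma size_pairup (T : Type) (s : seq T) : size (pairup s) = (size s)./2.
Proof. by elim/pairup_ind: s => //= x y s ->. Qed.

Lemma endpoints_pairup n (s : seq 'I_n) : subseq (endpoints (pairup s)) s.
Proof. by elim/pairup_ind: s => //= x y s IH; rewrite !eqxx. Qed.

Lemma increments_flatten (R : realType) n (a b : 'I_n -> R) (Bl : seq (seq ('I_n * 'I_n))) p :
  increments a b (flatten Bl) p = flatten [seq increments a b ws p | ws <- Bl].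
Proof. exact: map_flatten. Qed.

Lemma shape_nseq (T : eqType) (ss : seq (seq T)) m c : shape ss = nseq m c ->
  forall s, s \in ss -> size s = c.
Proof.
move=> E s sss; have : size s \in shape ss by apply: map_f.
by rewrite E mem_nseq => /andP[_ /eqP].
Qed.

Variables (R : realType) (n : nat) (a b : 'I_n -> R) (IA IB : {set 'I_n}).
Variables (va vb : seq R).
Hypotheses (ua : uniq va) (ub : uniq vb) (sa : (1 < size va)%N) (sb : (1 < size vb)%N).
Hypothesis unifa : forall h : R -> R,
  \sum_x unif R IA x * h (a x) = (\sum_(v <- va) h v) / (size va)%:R.
Hypothesis unifb : forall h : R -> R,
  \sum_x unif R IB x * h (b x) = (\sum_(v <- vb) h v) / (size vb)%:R.
Variables G q s : nat.
Hypotheses (G0 : (0 < G)%N) (IA0 : (0 < #|IA|)%N) (IB0 : (0 < #|IB|)%N).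
Hypotheses (bigA : (2 * (2 * q) ^ 2 <= #|IA|)%N) (bigB : (2 * (2 * q) ^ 2 <= #|IB|)%N).
Hypothesis room : (4 * (G * q * s) <= #|IA|)%N.

Lemma walk_blocks_le (a' : 'I_n -> R) p (Bl : seq (seq (seq ('I_n * 'I_n)))) :
  size Bl = G ->
  walk (increments a' b (flatten (flatten Bl)) p) 0 <=
  \sum_(bl <- Bl) (32 / (Num.sqrt G%:R * G%:R) *
     walk (increments a' b (chosen IB p bl) p) 0 +
     (all (pred1 0) (increments a' b (chosen IB p bl) p))%:R).
Proof.
move=> sBl; pose inc bl := increments a' b (flatten bl) p.
have sub bl : subseq (increments a' b (chosen IB p bl) p) (inc bl).
  by apply: map_subseq; exact: chosen_subseq.
have C0 : 0 <= 32 / (Num.sqrt G%:R * G%:R) :> R.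
  by apply: divr_ge0; rewrite ?mulr_ge0 ?ler0n ?sqrtr_ge0.
have E : increments a' b (flatten (flatten Bl)) p = flatten [seq inc bl | bl <- Bl].
  rewrite !increments_flatten; elim: (Bl) => //= bl l IH.
  by rewrite map_cat flatten_cat IH /inc increments_flatten.
(* If every block has walk at most 1/2, the mean bound applies. Otherwise some block has only zero
   increments, and its indicator pays for the trivial bound 1. *)
case: (boolP (all (fun bl => walk (inc bl) 0 <= 2^-1) Bl)) => [/allP h|/allPn[bl blB h]].
  rewrite E; apply: le_trans (walk_flatten_mean _ _) _.
  - by rewrite -size_eq0 size_map sBl -lt0n.
  - by move=> B /mapP[bl blB ->]; exact: h.
  rewrite size_map sBl mulr_sumr big_map; apply: ler_sum => bl _.
  apply: ler_wpDr; first exact: ler0n.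
  by apply: ler_wpM2l => //; exact: walk_subseq.
apply: le_trans (walk_0_le1 _) _.
have z : all (pred1 0) (inc bl).
  apply/allP => c cin /=; apply/negPn/negP => c0.
  by move/negP: h; apply; exact: walk_0_le_half cin c0.
rewrite (big_rem bl blB) /=.
have -> : all (pred1 0) (increments a' b (chosen IB p bl) p).
  by apply/allP => c /(mem_subseq (sub bl)); exact: (allP z).
have h1 : 0 <= 32 / (Num.sqrt G%:R * G%:R) * walk (increments a' b (chosen IB p bl) p) 0.
  by apply: mulr_ge0 => //; exact: walk_0_ge0.
have h2 : 0 <= \sum_(bl <- rem bl Bl) (32 / (Num.sqrt G%:R * G%:R) *
     walk (increments a' b (chosen IB p bl) p) 0 +
     (all (pred1 0) (increments a' b (chosen IB p bl) p))%:R) :> R.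
  apply: sumr_ge0 => bl' _; apply: addr_ge0; last exact: ler0n.
  by apply: mulr_ge0 => //; exact: walk_0_ge0.
by rewrite /=; lra.
Qed.

(** Bounds for a block of [q] lists: [miss] for the chance that some list has no useful pair, [e1]
    for the expected walk of the sampled increments, [e2] for the chance that all of these
    vanish. *)
Let miss : R := q%:R * (1 - #|IB|%:R / n%:R) ^+ s.
Let e1 : R := 9 / ((size va)%:R * (size vb)%:R) + (1 - 16000^-1) ^+ q.
Let e2 : R := (3 / 4) ^+ q.

Lemma probeq_bound x : probeq a b x <=
  32 / Num.sqrt G%:R * (miss + 4 * e1) + G%:R * (miss + 4 * e2).
Proof.
set P := take (2 * G * q * s) (pairup (enum IA)).
have sP : size P = (2 * G * q * s)%N.
  rewrite size_take_min size_pairup -cardE; apply/minn_idPl.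
  by rewrite geq_half_double -muln2; move: room; rewrite -!mulnA; lia.
set Subs := reshape (nseq (2 * G * q) s) P.
have fS : flatten Subs = P by apply: reshapeKr; rewrite sumn_nseq sP mulnC.
have shS : shape Subs = nseq (2 * G * q) s.
  by apply: reshapeKl; rewrite sumn_nseq sP mulnC.
have sS : size Subs = (2 * G * q)%N by rewrite -(size_map size) -/(shape _) shS size_nseq.
set Bl := reshape (nseq (2 * G) q) Subs.
have fB : flatten Bl = Subs by apply: reshapeKr; rewrite sumn_nseq sS mulnC.
have shB : shape Bl = nseq (2 * G) q.
  by apply: reshapeKl; rewrite sumn_nseq sS mulnC.
have sB : size Bl = (2 * G)%N by rewrite -(size_map size) -/(shape _) shB size_nseq.
have PA : subseq (endpoints P) (enum IA).
  exact: subseq_trans (subseq_endpoints (take_subseq _ _)) (endpoints_pairup _).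
have uP : uniq (endpoints P) by apply: subseq_uniq PA (enum_uniq _).
set Bl1 := take G Bl; set Bl2 := drop G Bl.
have sB1 : size Bl1 = G by rewrite size_take_min sB; apply/minn_idPl; lia.
have sB2 : size Bl2 = G by rewrite size_drop sB; lia.
have B12 : flatten (flatten Bl1) ++ flatten (flatten Bl2) = P.
  by rewrite -!flatten_cat cat_take_drop fB fS.
have fA0 : 0 < (#|IA|)`!%:R :> R by rewrite ltr0n fact_gt0.
have fn0 : 0 < n`!%:R :> R by rewrite ltr0n fact_gt0.
have gG0 : 0 < G%:R :> R by rewrite ltr0n.
set C : R := 32 / (Num.sqrt G%:R * G%:R).
have C0 : 0 <= C by apply: divr_ge0; rewrite ?mulr_ge0 ?ler0n ?sqrtr_ge0.
pose W r p bl := walk (increments (a \o r) b (chosen IB p bl) p) 0.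
pose Z r p bl := (all (pred1 0) (increments (a \o r) b (chosen IB p bl) p))%:R : R.
have H : (#|IA|)`!%:R * n`!%:R * probeq a b x <=
    \sum_(bl <- Bl) 2^-1 * (C * (\sum_(r : 'S_n | perm_on IA r) \sum_p W r p bl) +
      \sum_(r : 'S_n | perm_on IA r) \sum_p Z r p bl).
  have -> : (#|IA|)`!%:R * n`!%:R * probeq a b x =
      \sum_(r : 'S_n | perm_on IA r) n`!%:R * probeq (a \o r) b x.
    under eq_bigr => r _ do rewrite probeq_reindex.
    by rewrite sumr_const -card_perm -[RHS]mulr_natl mulrA.
  have -> : \sum_(bl <- Bl) 2^-1 * (C * (\sum_(r : 'S_n | perm_on IA r) \sum_p W r p bl) +
      \sum_(r : 'S_n | perm_on IA r) \sum_p Z r p bl) =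
     \sum_(r : 'S_n | perm_on IA r) \sum_p \sum_(bl <- Bl) 2^-1 * (C * W r p bl + Z r p bl).
    under [RHS]eq_bigr => r _ do rewrite exchange_big.
    rewrite [RHS]exchange_big /=; apply: eq_bigr => bl _.
    rewrite mulr_sumr -big_split mulr_sumr; apply: eq_bigr => r _ /=.
    by rewrite mulr_sumr -big_split mulr_sumr.
  apply: ler_sum => r _.
  apply: le_trans (@walk_le_swaps R n (a \o r) b (flatten (flatten Bl1)) (flatten (flatten Bl2)) x _) _; first by rewrite B12.
  apply: ler_sum => p _.
  rewrite -mulr_sumr ler_pM2l ?invr_gt0 //.
  rewrite -[X in \sum_(_ <- X) _](cat_take_drop G Bl) big_cat /=.
  by apply: lerD; exact: walk_blocks_le.
have kl0 : 0 < (size va)%:R * (size vb)%:R :> R.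
  by rewrite -natrM ltr0n muln_gt0 !(ltn_trans (ltn0Sn 0)).
have e10 : 0 <= e1.
  by apply: addr_ge0; [apply: divr_ge0 => //; exact: ltW | apply: exprn_ge0; lra].
have e20 : 0 <= e2 by apply: exprn_ge0; lra.
have blP bl : bl \in Bl -> [/\ size bl = q, subseq (flatten bl) P &
     forall ws, ws \in bl -> size ws = s].
  move=> blB; have sbS : subseq bl Subs by rewrite -fB; exact: mem_subseq_flatten.
  split; first exact: shape_nseq shB _ blB.
    rewrite -fS; elim: (Subs) bl sbS {blB} => [|t ts IH] [|u us] //=.
      by move=> _; exact: sub0seq.
    case: eqP => [->|_] h; first by apply: cat_subseq => //; exact: IH.
    by apply: subseq_trans (IH _ h) _; exact: suffix_subseq.
  by move=> ws /(mem_subseq sbS); exact: shape_nseq shS _.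
have HW bl : bl \in Bl -> \sum_(r : 'S_n | perm_on IA r) \sum_p W r p bl <=
    (#|IA|)`!%:R * n`!%:R * (miss + 4 * e1).
  move=> /blP[bq bP bs]; rewrite /miss -bq.
  apply: (@block_expect R n a b IA IB bl s (fun cs => walk cs 0)) => //.
  - by move=> cs; exact: walk_0_ge0.
  - by move=> cs; exact: walk_0_le1.
  - exact: subseq_uniq (subseq_endpoints bP) uP.
  - move=> w /(mem_subseq bP) wP; have : w.1 \in endpoints P.
      by apply/flatten_mapP; exists w => //; rewrite mem_head.
    by move/(mem_subseq PA); rewrite mem_enum.
  - by rewrite bq.
  - by rewrite bq.
  move=> ks pks; rewrite bq => sks; rewrite /e1.
  case: (ltrP 9 (expect2 a b IA IB ks (fun cs => walk cs 0) * ((size va)%:R * (size vb)%:R))) => h.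
    have := expect2_walk_0 ua ub sa sb unifa unifb IA0 IB0 pks h; rewrite sks => h1.
    by apply: ler_wpDl h1; apply: divr_ge0 => //; exact: ltW.
  apply: ler_wpDr; last by rewrite ler_pdivlMr.
  by apply: exprn_ge0; lra.
have HZ bl : bl \in Bl -> \sum_(r : 'S_n | perm_on IA r) \sum_p Z r p bl <=
    (#|IA|)`!%:R * n`!%:R * (miss + 4 * e2).
  move=> /blP[bq bP bs]; rewrite /miss -bq.
  apply: (@block_expect R n a b IA IB bl s (fun cs => (all (pred1 0) cs)%:R)) => //.
  - by move=> cs; rewrite lern1 leq_b1.
  - exact: subseq_uniq (subseq_endpoints bP) uP.
  - move=> w /(mem_subseq bP) wP; have : w.1 \in endpoints P.
      by apply/flatten_mapP; exists w => //; rewrite mem_head.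
    by move/(mem_subseq PA); rewrite mem_enum.
  - by rewrite bq.
  - by rewrite bq.
  move=> ks pks; rewrite bq => sks; rewrite /e2 -sks.
  by have /andP[] := expect2_all0 ua ub sa sb unifa unifb IA0 IB0 pks.
set K := (#|IA|)`!%:R * n`!%:R in H HW HZ.
have K0 : 0 < K by rewrite mulr_gt0.
rewrite -(ler_pM2l K0); apply: le_trans H _.
apply: (@le_trans _ _ (\sum_(bl <- Bl) 2^-1 *
    (C * (K * (miss + 4 * e1)) + K * (miss + 4 * e2)))).
  rewrite big_seq [leRHS]big_seq; apply: ler_sum => bl blB.
  rewrite ler_pM2l ?invr_gt0 //; apply: lerD; last exact: HZ.
  by apply: ler_wpM2l => //; exact: HW.
rewrite big_const_seq count_predT iter_addr_0 sB -[_ *+ _]mulr_natl natrM.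
have -> : 32 / Num.sqrt G%:R = C * G%:R.
  by rewrite /C invfM [_ * G%:R^-1]mulrC mulrCA mulrAC mulVf ?mul1r // gt_eqF.
lra.
Qed.

End Blocks.

(** * Multiplicity profiles *)

Section Profile.
Set Implicit Arguments.
Unset Strict Implicit.
Variable R : realType.

Lemma harmonic_le_ln m : \sum_(i < m.+2) (i%:R : R)^-1 <= 1 + ln m.+1%:R.
Proof.
elim: m => [|m IH].
  by rewrite !big_ord_recr big_ord0 /= invr0 invr1 ln1; lra.
rewrite big_ord_recr /=; set S := \sum_(i < m.+2) _ in IH *.
have m1 : 0 < m.+1%:R :> R by rewrite ltr0n.
have m2 : 0 < m.+2%:R :> R by rewrite ltr0n.
have E : 1 - m.+2%:R^-1 = m.+1%:R / m.+2%:R :> R.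
  rewrite -[X in X - _](divff (lt0r_neq0 m2)) -[X in _ - X]mul1r -mulrBl.
  by rewrite -[m.+2%:R]natr1 addrK.
have : ln (1 - m.+2%:R^-1) <= - m.+2%:R^-1 :> R.
  by apply: le_ln1Dx; rewrite ltrN2 invf_lt1 ?ltr1n.
rewrite E ln_div ?posrE //.
by move: IH; move: (ln _) (ln _) (_^-1) => x y z; lra.
Qed.

Variables (n : nat) (a : 'I_n -> R).
Let s := msetOf a.
Let mu := mult_profile s.

Lemma size_msetOf : size s = n.
Proof. by rewrite size_map size_enum_ord. Qed.

Lemma size_profile_le : (size mu <= n)%N.
Proof. by rewrite size_sort size_map -size_msetOf size_undup. Qed.

Lemma profile_le i : (nth 0 mu i <= n)%N.
Proof.
case: (ltnP i (size mu)) => hi; last by rewrite nth_default.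
have := mem_nth 0%N hi; rewrite mem_sort => /mapP[x _ ->].
by rewrite -size_msetOf count_size.
Qed.

Lemma Mprof_le : (Mprof s <= n ^ 4)%N.
Proof.
rewrite /Mprof -/mu.
apply: (@leq_trans (\sum_(i < size mu) n ^ 3)).
  apply: leq_sum => i _; rewrite [(n ^ 3)%N]expnSr; apply: leq_mul (profile_le i).
  by rewrite leq_sqr (leq_trans (ltnW (ltn_ord i))) // size_profile_le.
by rewrite sum_nat_const card_ord expnS leq_mul2r size_profile_le orbT.
Qed.

Lemma Mprof_max : (0 < Mprof s)%N -> exists i, [/\ (0 < i < size mu)%N,
  (0 < nth 0 mu i)%N & (Mprof s)%:R <= (i ^ 3 * nth 0 mu i)%:R * (1 + ln n%:R) :> R].
Proof.
move=> M0; pose g (i : nat) := (i ^ 3 * nth 0 mu i)%N.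
have [m Em] : exists m, size mu = m.+1.
  case E: (size mu) => [|m]; last by exists m.
  by move: M0; rewrite /Mprof -/mu E big_ord0.
pose i := [arg max_(i > (ord0 : 'I_m.+1)) g i].
have gi j : (j < size mu)%N -> (g j <= g i)%N.
  rewrite Em => jm; rewrite /i; case: arg_maxnP => // k _ H.
  exact: (H (Ordinal jm)).
have H : (Mprof s)%:R <= (g i)%:R * \sum_(j < size mu) (j%:R : R)^-1.
  rewrite /Mprof -/mu natr_sum mulr_sumr; apply: ler_sum => j _.
  case: (posnP j) => [->|j0]; first by rewrite mul0n invr0 mulr0.
  rewrite ler_pdivlMr ?ltr0n // -natrM ler_nat.
  by apply: leq_trans (gi _ (ltn_ord j)); rewrite /g [(_ ^ 3)%N]expnSr mulnAC.
have n0 : (0 < n)%N by rewrite (leq_trans _ size_profile_le) // Em.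
have H2 : \sum_(j < size mu) (j%:R : R)^-1 <= 1 + ln n%:R.
  have := size_profile_le; rewrite Em; case: (m) => [|m'] hm.
    by rewrite big_ord_recr big_ord0 /= invr0 !add0r addr_ge0 // ln_ge0 // ler1n.
  apply: le_trans (harmonic_le_ln _) _; rewrite lerD2l.
  by rewrite ler_ln ?posrE ?ltr0n // ler_nat ltnW.
have g0 : (0 < g i)%N.
  rewrite lt0n; apply/negP => /eqP gi0; move: H.
  by rewrite gi0 mul0r lern0 -leqn0 leqNgt M0.
exists i; split.
- rewrite Em ltn_ord andbT lt0n; apply/negP => /eqP i0.
  by move: g0; rewrite /g i0.
- by move: g0; rewrite /g muln_gt0 => /andP[].
- by apply: le_trans H _; apply: ler_wpM2l.
Qed.

Lemma uniform_subset (va : seq R) S : uniq va -> va != [::] -> (0 < S)%N ->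
  (forall v, v \in va -> (S <= count_mem v s)%N) ->
  exists2 IA : {set 'I_n}, #|IA| = (size va * S)%N &
  forall h : R -> R,
    \sum_x unif R IA x * h (a x) = (\sum_(v <- va) h v) / (size va)%:R.
Proof.
move=> uva va0 S0 hS.
pose f v := take S (enum [pred i | a i == v]).
have fP v x : x \in f v -> a x = v.
  by move/mem_take; rewrite mem_enum inE => /eqP.
have sf v : v \in va -> size (f v) = S.
  move=> /hS h; rewrite size_takel // -cardE; apply: leq_trans h _.
  rewrite /s /msetOf -sum1_count big_map big_enum_cond -sum1_card; apply: eq_leq.
  by apply: eq_bigl => i; rewrite !inE.
pose L := flatten [seq f v | v <- va].
have uL : uniq L.
  rewrite /L; elim: (va) uva => //= v l IH /andP[vl ul].
  rewrite cat_uniq take_uniq ?enum_uniq // IH // andbT.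
  apply/hasPn => x /flatten_mapP[v' v'l /fP ax]; apply/negP => /fP ax'.
  by move: vl; rewrite -ax' ax v'l.
have sL : size L = (size va * S)%N.
  rewrite /L size_flatten /shape -map_comp sumnE big_map big_seq.
  rewrite (eq_bigr (fun=> S)); last by move=> v /sf.
  by rewrite -big_seq big_const_seq count_predT iter_addn_0 mulnC.
exists [set x in L]; first by rewrite cardsE (card_uniqP uL).
move=> h; rewrite /unif cardsE (card_uniqP uL) sL.
have -> : \sum_x (x \in [set x in L])%:R / (size va * S)%:R * h (a x) =
   (\sum_(x <- L) h (a x)) / (size va * S)%:R.
  rewrite [in RHS]big_uniq // mulr_suml [RHS]big_mkcond /=; apply: eq_bigr => x _.
  by rewrite inE; case: (x \in L); rewrite ?mul0r // mul1r mulrC.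
have -> : \sum_(x <- L) h (a x) = S%:R * \sum_(v <- va) h v.
  rewrite /L big_flatten big_map mulr_sumr; apply: eq_big_seq => v vva.
  rewrite (eq_big_seq (fun=> h v)); last by move=> x /fP ->.
  by rewrite big_const_seq count_predT iter_addr_0 sf // mulr_natl.
by rewrite natrM [S%:R * _]mulrC -mulrA invfM [S%:R * (_ / _)]mulrCA divff ?mulr1 // pnatr_eq0 -lt0n.
Qed.

Lemma profile_extract : (0 < Mprof s)%N -> exists (IA : {set 'I_n}) (va : seq R) (S : nat),
  [/\ uniq va, (1 < size va)%N, (0 < S)%N /\ #|IA| = (size va * S)%N,
   forall h : R -> R, \sum_x unif R IA x * h (a x) = (\sum_(v <- va) h v) / (size va)%:R &
   (Mprof s)%:R <= (size va)%:R ^+ 3 * S%:R * (1 + ln n%:R) :> R].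
Proof.
move=> /Mprof_max[i [/andP[i0 im] S0 H]].
pose f (v : R) := count_mem v s.
pose u := sort (relpre f geq) (undup s).
have Emu : mu = map f u by rewrite /mu /mult_profile sort_map.
have su : size u = size mu by rewrite Emu size_map.
have uu : uniq u by rewrite sort_uniq undup_uniq.
pose va := take i.+1 u.
have sva : size va = i.+1 by rewrite size_takel // su.
have srt : sorted geq mu by apply: sort_sorted => x y; exact: leq_total.
have hS v : v \in va -> (nth 0 mu i <= count_mem v s)%N.
  move=> vva; have jv : (index v va < i.+1)%N by rewrite -sva index_mem.
  have -> : count_mem v s = nth 0 mu (index v va).
    rewrite Emu (nth_map 0) ?su; last exact: leq_trans jv im.
    by rewrite -(nth_take _ jv) nth_index.
  have := @sorted_leq_nth _ geq (fun x y z h1 h2 => leq_trans h2 h1) leqnn 0%N _ srt.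
  by apply; rewrite ?inE //; exact: leq_trans jv im.
have uva : uniq va by rewrite take_uniq.
have va0 : va != [::] by rewrite -size_eq0 sva.
have [IA cIA hIA] := uniform_subset uva va0 S0 hS.
exists IA, va, (nth 0%N mu i); split => //; first by rewrite sva ltnS.
apply: le_trans H _; apply: ler_wpM2r.
  by rewrite addr_ge0 // ln_ge0 // ler1n (leq_trans _ size_profile_le) // (leq_trans _ im).
by rewrite -natrX -natrM ler_nat sva leq_mul2r leq_exp2r ?leqnSn ?orbT.
Qed.

End Profile.

(** * Choice of parameters *)

Section ChoiceOfParameters.
Set Implicit Arguments.
Unset Strict Implicit.
Variable R : realType.

Lemma natS_between (t : R) : 0 <= t -> exists m : nat, t <= m%:R /\ m%:R <= t + 1.
Proof.
move=> t0; have /andP[h1 h2] := truncn_itv t0.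
exists (Num.truncn t).+1; split; first exact: ltW.
by rewrite -natr1 lerD2r.
Qed.

Lemma expr_1sub_le (w c : R) m : 0 <= 1 - w -> c <= w * m%:R ->
  (1 - w) ^+ m <= expR (- c).
Proof.
move=> w1 cw; apply: (@le_trans _ _ (expR (- w) ^+ m)).
  by apply: lerXn2r; rewrite ?nnegrE ?expR_ge0 //; exact: expR_ge1Dx.
by rewrite -expRM_natr ler_expR mulNr lerN2.
Qed.

Lemma expRN_ln_nat (n c : nat) : (0 < n)%N ->
  expR (- (c%:R * ln n%:R)) = (n%:R ^+ c)^-1 :> R.
Proof.
by move=> n0; rewrite expRN expRM_natl lnK // posrE ltr0n.
Qed.

Variables (n x y kl : nat) (z D L : R).
Hypothesis LE : L = ln n%:R.
Hypotheses (z0 : 0 < z) (z1 : z <= 4^-1) (DE : D = 5 / z + 1).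
Hypotheses (n1 : (0 < n)%N) (L1 : 1 <= L) (x0 : (0 < x)%N) (y0 : (0 < y)%N).
Hypotheses (xn : (x <= n)%N) (yn : (y <= n)%N) (kl0 : (0 < kl)%N) (kln : (kl <= n ^ 2)%N).
Hypothesis xyK : (28 * D + 8 * D ^+ 2) * (n%:R * L ^+ 2) <= x%:R * y%:R.

Lemma D_gt1 : 1 < D.
Proof. by rewrite DE ltrDr divr_gt0. Qed.

Lemma exists_q : exists q : nat,
  [/\ 5 * L <= z * q%:R, q%:R <= D * L, (2 * (2 * q) ^ 2 <= x)%N & (2 * (2 * q) ^ 2 <= y)%N].
Proof.
have [[hL hz0] [hz1 hK]] := ((L1, z0), (z1, xyK)).
have t0 : 0 <= 5 * L / z by apply: divr_ge0; [lra | exact: ltW].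
have [q [q1 q2]] := natS_between t0.
have qD : q%:R <= D * L.
  have -> : D * L = 5 * L / z + L by rewrite DE; ring.
  by apply: le_trans q2 _; rewrite lerD2l.
have D1 := D_gt1.
have nR : 0 < n%:R :> R by rewrite ltr0n.
have key : 8 * q%:R ^+ 2 * n%:R <= x%:R * y%:R :> R.
  apply: le_trans xyK.
  have DL : 0 <= D * L by apply: mulr_ge0; lra.
  have : q%:R ^+ 2 <= (D * L) ^+ 2 by rewrite ler_sqr ?nnegrE ?ler0n.
  move=> /(ler_wpM2r (ltW nR)).
  have : 0 <= D * (n%:R * L ^+ 2).
    by apply: mulr_ge0; [lra | apply: mulr_ge0 (ltW nR) (sqr_ge0 L)].
  rewrite exprMn; lra.
have key' : (8 * q ^ 2 * n <= x * y)%N.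
  by move: key; rewrite -natrX -!natrM ler_nat.
exists q; split => //.
- by rewrite [z * _]mulrC -ler_pdivrMr.
- rewrite -(leq_pmul2r n1) expnMn mulnA.
  by apply: leq_trans key' _; rewrite leq_mul2l yn orbT.
- rewrite -(leq_pmul2r n1) expnMn mulnA.
  by apply: leq_trans key' _; rewrite mulnC leq_mul2l xn orbT.
Qed.

Lemma exists_s : exists s : nat,
  [/\ (0 < s)%N, 6 * L <= y%:R / n%:R * s%:R & s%:R * y%:R <= 7 * (n%:R * L)].
Proof.
have [[hL hz0] [hz1 hK]] := ((L1, z0), (z1, xyK)).
have nR : 0 < n%:R :> R by rewrite ltr0n.
have yR : 0 < y%:R :> R by rewrite ltr0n.
have nL : n%:R <= n%:R * L by rewrite ler_peMr // ltW.
have yn' : y%:R <= n%:R :> R by rewrite ler_nat.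
have t0 : 0 <= 6 * (n%:R * L) / y%:R by apply: divr_ge0; [lra | exact: ltW].
have [s [s1 s2]] := natS_between t0.
have sy : 6 * (n%:R * L) <= s%:R * y%:R by rewrite -ler_pdivrMr.
exists s; split.
- rewrite lt0n; apply/negP => /eqP s0; move: sy; rewrite s0 mul0r; lra.
- rewrite mulrAC ler_pdivlMr //; lra.
- apply: le_trans (ler_wpM2r (ltW yR) s2) _.
  rewrite mulrDl mul1r divfK ?gt_eqF //; lra.
Qed.

(* [q] makes [(1 - z)^q <= n^-5] and [s] makes [q (1 - y / n)^s <= n^-5]; then [G] is
   as large as the [x / 2] available pairs allow for [2 G] blocks of [q s] pairs. *)
Lemma parameters : exists G q s : nat,
  [/\ (0 < G)%N, (2 * (2 * q) ^ 2 <= x)%N, (2 * (2 * q) ^ 2 <= y)%N,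
      (4 * (G * q * s) <= x)%N &
  let miss := q%:R * (1 - y%:R / n%:R) ^+ s in
  32 / Num.sqrt G%:R * (miss + 4 * (9 / kl%:R + (1 - z) ^+ q)) +
     G%:R * (miss + 4 * (3 / 4) ^+ q) <=
  1317 * Num.sqrt (56 * D) * (Num.sqrt n%:R * L) / (Num.sqrt (x%:R * y%:R) * kl%:R)].
Proof.
have [[hL hz0] [hz1 hK]] := ((L1, z0), (z1, xyK)).
have [q [q1 q2 qx qy]] := exists_q; have [s [s0 s1 s2]] := exists_s.
have D1 := D_gt1.
have nR : 0 < n%:R :> R by rewrite ltr0n.
have yR : 0 < y%:R :> R by rewrite ltr0n.
have xR : 0 < x%:R :> R by rewrite ltr0n.
have q0 : (0 < q)%N.
  rewrite lt0n; apply/negP => /eqP q0; move: q1; rewrite q0 mulr0; lra.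
have qs0 : (0 < 4 * (q * s))%N by rewrite !muln_gt0 q0 s0.
have qsy : q%:R * s%:R * y%:R <= D * 7 * (n%:R * L ^+ 2).
  have : q%:R * (s%:R * y%:R) <= D * L * (7 * (n%:R * L)).
    by apply: ler_pM => //; rewrite mulr_ge0 ?ler0n.
  rewrite expr2; lra.
have nL2 : 0 <= n%:R * L ^+ 2 by rewrite mulr_ge0 ?sqr_ge0 // ltW.
have qsx : (4 * (q * s) <= x)%N.
  rewrite -(ler_nat R) -(ler_pM2r yR) !natrM.
  apply: le_trans xyK.
  have : 0 <= D ^+ 2 * (n%:R * L ^+ 2) by rewrite mulr_ge0 ?sqr_ge0.
  lra.
set G := (x %/ (4 * (q * s)))%N.
have G0 : (0 < G)%N by rewrite divn_gt0.
have Gx : (4 * (G * q * s) <= x)%N.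
  by rewrite -mulnA mulnCA; exact: leq_divM.
have xG : x%:R <= 8 * (q%:R * s%:R) * G%:R :> R.
  have : (x <= G.+1 * (4 * (q * s)))%N by apply: ltnW; exact: ltn_ceil.
  move=> h; have : (x <= 8 * (q * s) * G)%N.
    apply: (leq_trans h); rewrite [leqRHS]mulnC.
    have -> : (8 * (q * s) = 2 * (4 * (q * s)))%N by rewrite [RHS]mulnA.
    move: (4 * (q * s))%N => w.
    by rewrite mulnA leq_mul2r muln2 -addnn -addn1 leq_add2l G0 orbT.
  by rewrite -(ler_nat R) !natrM.
have GR : 0 < G%:R :> R by rewrite ltr0n.
have klR : 0 < kl%:R :> R by rewrite ltr0n.
have Gn : G%:R <= n%:R :> R by rewrite ler_nat (leq_trans (leq_div _ _)).
have sG0 : 0 < Num.sqrt (G%:R : R) by rewrite sqrtr_gt0.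
have sGG : Num.sqrt (G%:R : R) <= G%:R.
  rewrite -[leRHS]ger0_norm ?ler0n // -sqrtr_sqr ler_sqrt ?sqr_ge0 //.
  by rewrite -natrX ler_nat -mulnn leq_pmull.
exists G, q, s; split => // miss.
have n5 : 0 < n%:R ^+ 5 :> R by rewrite exprn_gt0.
have yn1 : y%:R / n%:R <= 1 :> R by rewrite ler_pdivrMr // mul1r ler_nat.
have qn : q%:R <= n%:R :> R.
  rewrite ler_nat (leq_trans _ yn) // (leq_trans _ qy) //.
  by clear; rewrite -mulnn; nia.
have hmiss : miss <= (n%:R ^+ 5)^-1.
  have h : (1 - y%:R / n%:R) ^+ s <= (n%:R ^+ 6)^-1 :> R.
    rewrite -expRN_ln_nat // -LE; apply: expr_1sub_le; last exact: s1.
    by rewrite subr_ge0.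
  apply: le_trans (ler_pM _ _ qn h) _; rewrite ?ler0n ?exprn_ge0 ?subr_ge0 //.
  by rewrite exprS invfM mulrA divff ?mul1r // gt_eqF.
have hz : (1 - z) ^+ q <= (n%:R ^+ 5)^-1.
  by rewrite -expRN_ln_nat // -LE; apply: expr_1sub_le => //; lra.
have h34 : (3 / 4) ^+ q <= (n%:R ^+ 5)^-1 :> R.
  have h : 3 / 4 <= 1 - z by lra.
  by apply: le_trans hz; apply: lerXn2r h; rewrite nnegrE; lra.
have sx : (Num.sqrt (G%:R : R))^-1 <= Num.sqrt (56 * D) * (Num.sqrt n%:R * L) / Num.sqrt (x%:R * y%:R).
  have D0 : 0 <= 56 * D by lra.
  have -> : Num.sqrt n%:R * L = Num.sqrt (n%:R * L ^+ 2).
    by rewrite sqrtrM ?ler0n // sqrtr_sqr ger0_norm //; lra.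
  rewrite -sqrtrM // ler_pdivlMr; last first.
    by rewrite sqrtr_gt0 mulr_gt0.
  have P0 := mulr_ge0 D0 nL2.
  rewrite mulrC ler_pdivrMr // -sqrtrM // ler_sqrt; last first.
    exact: mulr_ge0 P0 (ltW GR).
  have h1 : x%:R * y%:R <= 8 * (q%:R * s%:R) * G%:R * y%:R
    := ler_wpM2r (ltW yR) xG.
  have h2 : (q%:R * s%:R * y%:R) * G%:R <= D * 7 * (n%:R * L ^+ 2) * G%:R
    := ler_wpM2r (ltW GR) qsy.
  lra.
have n5kl : (n%:R ^+ 5)^-1 <= kl%:R^-1 :> R.
  rewrite lef_pV2 ?posrE // -natrX ler_nat (leq_trans kln) // leq_pexp2l //.
have G5 : G%:R * (n%:R ^+ 5)^-1 <= (Num.sqrt (G%:R : R))^-1 / kl%:R.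
  rewrite -invfM ler_pdivrMr // mulrC ler_pdivlMr ?mulr_gt0 //.
  apply: (@le_trans _ _ (G%:R * (G%:R * kl%:R))).
    by rewrite ler_pM2l // ler_pM2r.
  rewrite -natrX -!natrM ler_nat.
  apply: (@leq_trans (n * (n * n ^ 2))).
    by rewrite !leq_mul // (leq_trans (leq_div _ _)).
  by rewrite -!expnS leq_pexp2l.
set N5 := (n%:R ^+ 5)^-1 in hmiss hz h34 n5kl G5.
set SG := (Num.sqrt (G%:R : R))^-1 in sx G5 *.
set KL := kl%:R^-1 in n5kl G5 *.
have SG0 : 0 <= SG by rewrite invr_ge0 ltW.
have KL0 : 0 <= KL by rewrite invr_ge0 ltW.
have T1 : SG * (miss + 4 * (9 * KL + (1 - z) ^+ q)) <= SG * (41 * KL).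
  by apply: ler_wpM2l => //; lra.
have T2 : G%:R * (miss + 4 * (3 / 4) ^+ q) <= G%:R * (5 * N5).
  by apply: ler_wpM2l; [exact: ltW | lra].
have T3 := ler_wpM2r KL0 sx.
rewrite [_ / (_ * kl%:R)]mulrC invfM -/KL.
lra.
Qed.

End ChoiceOfParameters.

Section Conclusion.
Set Implicit Arguments.
Unset Strict Implicit.
Variable R : realType.

Lemma Qconc_le n (a b : 'I_n -> R) (c : R) : 0 <= c ->
  (forall x, probeq a b x <= c) -> Qconc a b <= c.
Proof.
by move=> c0 H; rewrite /Qconc; elim/big_ind: _ => // u v; rewrite ge_max => -> ->.
Qed.

Lemma probeq_le1 n (a b : 'I_n -> R) x : probeq a b x <= 1.
Proof.
rewrite /probeq ler_pdivrMr ?ltr0n ?fact_gt0 // mul1r ler_nat -card_Sn.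
exact: max_card.
Qed.

Lemma Qconc_le_trivial n (a b : 'I_n -> R) (N : R) : (1 < n)%N -> n%:R <= N ->
  let M := (Mprof (msetOf a) * Mprof (msetOf b))%:R : R in 0 < M ->
  Qconc a b <= N ^+ 4 / ln 2 ^+ 2 * (Num.sqrt n%:R * ln n%:R ^+ 2) / Num.sqrt M.
Proof.
move=> n1 nN M M0; have sM0 : 0 < Num.sqrt M by rewrite sqrtr_gt0.
have l20 : 0 < ln 2 :> R by apply: ln_gt0; rewrite ltr1n.
have lle : ln 2 <= ln n%:R :> R by rewrite ler_ln ?posrE ?ltr0n ?(ltnW n1) // ler_nat.
have n1R : 1 <= n%:R :> R by rewrite ler1n ltnW.
have N0 : 0 <= N by apply: le_trans nN; rewrite ler0n.
have big : 1 <= N ^+ 4 / ln 2 ^+ 2 * (Num.sqrt n%:R * ln n%:R ^+ 2) / Num.sqrt M.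
  rewrite ler_pdivlMr // mul1r.
  have h1 : Num.sqrt M <= N ^+ 4.
    have n4 : M <= (n%:R ^+ 4) ^+ 2.
      by rewrite -!natrX ler_nat -mulnn leq_mul // Mprof_le.
    apply: (@le_trans _ _ (n%:R ^+ 4)); last by rewrite lerXn2r ?nnegrE ?ler0n.
    by rewrite -[leRHS]ger0_norm ?exprn_ge0 ?ler0n // -sqrtr_sqr ler_sqrt ?sqr_ge0.
  apply: (le_trans h1).
  rewrite mulrAC -mulrA ler_peMr ?exprn_ge0 //.
  rewrite ler_pdivlMr ?exprn_gt0 // mul1r.
  apply: (@le_trans _ _ (ln n%:R ^+ 2)).
    by apply: lerXn2r; rewrite // nnegrE ltW // (lt_le_trans l20).
  rewrite ler_peMl ?sqr_ge0 //.
  by rewrite -[leLHS]sqrtr1 ler_sqrt ?ler0n.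
apply: Qconc_le; first exact: le_trans ler01 big.
by move=> x; apply: le_trans (probeq_le1 _ _ _) big.
Qed.

Lemma expR_ge_pow (eps L c : R) : 0 < eps -> 0 <= L -> c / (eps / 9) ^+ 9 <= L ->
  c * L ^+ 8 <= expR (eps * L).
Proof.
move=> e0 L0 cL; set w := eps / 9 in cL *.
have w0 : 0 < w by rewrite divr_gt0.
have -> : eps * L = 9%:R * (w * L) by rewrite mulrA [_ * w]mulrC divfK.
rewrite expRM_natl.
apply: (@le_trans _ _ ((w * L) ^+ 9)).
  have -> : (w * L) ^+ 9 = L * w ^+ 9 * L ^+ 8 by ring.
  apply: ler_wpM2r; first exact: exprn_ge0.
  by rewrite -ler_pdivrMr // exprn_gt0.
apply: lerXn2r; rewrite ?nnegrE ?expR_ge0 //; first by rewrite mulr_ge0 // ltW.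
by apply: le_trans (expR_ge1Dx _); rewrite ler_wpDl.
Qed.

Lemma Qconc_le_large n (a b : 'I_n -> R) (eps z D : R) : (1 < n)%N ->
  let M := (Mprof (msetOf a) * Mprof (msetOf b))%:R : R in
  0 < eps -> z = 16000^-1 -> D = 5 / z + 1 -> 1 <= ln n%:R :> R ->
  4 * (28 * D + 8 * D ^+ 2) ^+ 3 / (eps / 9) ^+ 9 <= ln n%:R ->
  n%:R `^ (3 + eps) <= M ->
  Qconc a b <= 2634 * Num.sqrt (56 * D) * (Num.sqrt n%:R * ln n%:R ^+ 2) / Num.sqrt M.
Proof.
move=> n1 M e0 zE DE L1 hL hM; have n0 : (0 < n)%N by rewrite ltnW.
have nR : 0 < n%:R :> R by rewrite ltr0n.
have z0 : 0 < z by rewrite zE invr_gt0 ltr0n.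
have z4 : z <= 4^-1 by rewrite zE; lra.
have D1 : 1 < D by rewrite DE ltrDr divr_gt0.
set L := ln n%:R in L1 hL *; set K := 28 * D + 8 * D ^+ 2 in hL.
have L0 : 0 <= L by exact: le_trans ler01 L1.
have D0 : 0 <= D by exact: ltW (lt_trans ltr01 D1).
have K0 : 0 <= K.
  exact: addr_ge0 (mulr_ge0 (ler0n _ _) D0) (mulr_ge0 (ler0n _ _) (sqr_ge0 D)).
have M0 : 0 < M by apply: lt_le_trans hM; exact: powR_gt0.
have : (0 < Mprof (msetOf a) * Mprof (msetOf b))%N by rewrite -(ltr0n R).
rewrite muln_gt0 => /andP[Ma0 Mb0].
have [IA [va [S [uva sva [S0 cA] hA hMa]]]] := profile_extract Ma0.
have [IB [vb [T [uvb svb [T0 cB] hB hMb]]]] := profile_extract Mb0.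
have nL : n%:R `^ (3 + eps) = n%:R ^+ 3 * expR (eps * L).
  rewrite powRD; last by rewrite (gt_eqF nR) implybT.
  by rewrite powR_mulrn ?ler0n // /powR (gt_eqF nR).
have hE := expR_ge_pow e0 (le_trans ler01 L1) hL.
have IA0 : (0 < #|IA|)%N by rewrite cA muln_gt0 S0 (ltnW sva).
have IB0 : (0 < #|IB|)%N by rewrite cB muln_gt0 T0 (ltnW svb).
have IAn : (#|IA| <= n)%N by rewrite -[leqRHS](card_ord n) max_card.
have IBn : (#|IB| <= n)%N by rewrite -[leqRHS](card_ord n) max_card.
set kl := (size va * size vb)%N.
have kl0 : (0 < kl)%N by rewrite muln_gt0 (ltnW sva) (ltnW svb).
have kln : (kl <= n ^ 2)%N.
  rewrite -mulnn leq_mul //; first by apply: leq_trans IAn; rewrite cA leq_pmulr.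
  by apply: leq_trans IBn; rewrite cB leq_pmulr.
set k : R := (size va)%:R in hMa; set l : R := (size vb)%:R in hMb.
set x : R := #|IA|%:R; set y : R := #|IB|%:R.
have xE : x = k * S%:R by rewrite /x cA natrM.
have yE : y = l * T%:R by rewrite /y cB natrM.
have k0 : 0 < k by rewrite ltr0n (ltnW sva).
have l0 : 0 < l by rewrite ltr0n (ltnW svb).
have SR : 1 <= S%:R :> R by rewrite ler1n.
have TR : 1 <= T%:R :> R by rewrite ler1n.
have x0 : 0 < x by rewrite ltr0n.
have y0 : 0 < y by rewrite ltr0n.
set P := (k ^+ 3 * S%:R) * (l ^+ 3 * T%:R).
have kS0 : 0 <= k ^+ 3 * S%:R.
  by apply: mulr_ge0; [exact: exprn_ge0 (ltW k0) | exact: ler0n].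
have lT0 : 0 <= l ^+ 3 * T%:R.
  by apply: mulr_ge0; [exact: exprn_ge0 (ltW l0) | exact: ler0n].
have hP : M <= P * (4 * L ^+ 2).
  have -> : P * (4 * L ^+ 2) = (k ^+ 3 * S%:R * (2 * L)) * (l ^+ 3 * T%:R * (2 * L)).
    by rewrite /P; ring.
  have L2 : 1 + L <= 2 * L by rewrite mulr_natl mulr2n lerD2r.
  rewrite /M natrM; apply: ler_pM; rewrite ?ler0n //.
    by apply: le_trans hMa _; apply: ler_wpM2l.
  by apply: le_trans hMb _; apply: ler_wpM2l.
have L20 : 0 < L ^+ 2 by rewrite exprn_gt0 // (lt_le_trans ltr01).
have hxy : K * (n%:R * L ^+ 2) <= x * y.
  have h3 : (K * (n%:R * L ^+ 2)) ^+ 3 <= (x * y) ^+ 3.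
    have e : (K * (n%:R * L ^+ 2)) ^+ 3 * (4 * L ^+ 2) =
        n%:R ^+ 3 * (4 * K ^+ 3 * L ^+ 8) by ring.
    have c4 : 0 < 4 * L ^+ 2 by rewrite mulr_gt0.
    rewrite -(ler_pM2r c4) e.
    apply: le_trans (ler_wpM2l (exprn_ge0 3 (ltW nR)) hE) _.
    rewrite -nL; apply: (le_trans hM); apply: (le_trans hP).
    apply: ler_wpM2r; first by rewrite mulr_ge0 // ltW.
    rewrite xE yE exprMn [(k * _) ^+ 3]exprMn [(l * _) ^+ 3]exprMn.
    by apply: ler_pM; rewrite ?mulr_ge0 ?exprn_ge0 ?ler0n ?(ltW k0) ?(ltW l0) //;
      apply: ler_wpM2l; rewrite ?exprn_ge0 ?(ltW k0) ?(ltW l0) // ler_eXnr.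
  have KL0 : 0 <= K * (n%:R * L ^+ 2).
    by apply: mulr_ge0 => //; apply: mulr_ge0; exact: ltW.
  by move: h3; rewrite ler_pXn2r // nnegrE mulr_ge0 ?(ltW x0) ?(ltW y0).
have [G [q [s [G0 qA qB Gqs H]]]] :=
  parameters (erefl L) z0 z4 DE n0 L1 IA0 IB0 IAn IBn kl0 kln hxy.
have sM0 : 0 < Num.sqrt M by rewrite sqrtr_gt0.
have xy0 : 0 < x * y by rewrite mulr_gt0.
have klR : 0 < kl%:R :> R by rewrite ltr0n.
have sxy0 : 0 < Num.sqrt (x * y) by rewrite sqrtr_gt0.
have fin : 1317 * Num.sqrt (56 * D) * (Num.sqrt n%:R * L) / (Num.sqrt (x * y) * kl%:R) <=
   2634 * Num.sqrt (56 * D) * (Num.sqrt n%:R * L ^+ 2) / Num.sqrt M.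
  have hs : Num.sqrt M <= 2 * L * (Num.sqrt (x * y) * kl%:R).
    have c0 : 0 <= 2 * L * (Num.sqrt (x * y) * kl%:R).
      exact: mulr_ge0 (mulr_ge0 (ler0n _ _) L0) (mulr_ge0 (sqrtr_ge0 _) (ler0n _ _)).
    rewrite -[leRHS]ger0_norm // -sqrtr_sqr ler_sqrt ?sqr_ge0 //.
    rewrite !exprMn sqr_sqrtr ?(ltW xy0) //; apply: (le_trans hP).
    by rewrite /P xE yE /kl natrM -/k -/l le_eqVlt; apply/orP; left; apply/eqP; ring.
  have A0 : 0 <= 1317 * Num.sqrt (56 * D) * (Num.sqrt n%:R * L).
    exact: mulr_ge0 (mulr_ge0 (ler0n _ _) (sqrtr_ge0 _)) (mulr_ge0 (sqrtr_ge0 _) L0).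
  have c0 : 0 < Num.sqrt (x * y) * kl%:R by rewrite mulr_gt0.
  rewrite ler_pdivrMr // [_ / Num.sqrt M * _]mulrAC ler_pdivlMr //.
  apply: le_trans (ler_wpM2l A0 hs) _.
  rewrite le_eqVlt; apply/orP; left; apply/eqP; ring.
apply: Qconc_le.
  apply: divr_ge0 (sqrtr_ge0 _).
  exact: mulr_ge0 (mulr_ge0 (ler0n _ _) (sqrtr_ge0 _)) (mulr_ge0 (sqrtr_ge0 _) (sqr_ge0 _)).
move=> v; apply: le_trans fin; apply: le_trans H.
have := probeq_bound uva uvb sva svb hA hB G0 IA0 IB0 qA qB Gqs v.
by rewrite zE /kl natrM.
Qed.

Lemma Mprof_gt0_size n (a : 'I_n -> R) : (0 < Mprof (msetOf a))%N -> (1 < n)%N.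
Proof.
move=> /(@Mprof_max R)[i [/andP[i0 im] _ _]].
exact: leq_ltn_trans i0 (leq_trans im (size_profile_le a)).
Qed.

End Conclusion.

Theorem theorem1p3 (R : realType) (eps : R) (heps : 0 < eps) :
  exists C : R, forall (n : nat) (a b : 'I_n -> R),
    (0 < n)%N ->
    (n%:R `^ (3 + eps) <= ((Mprof (msetOf a)) * (Mprof (msetOf b)))%:R) ->
    Qconc a b <=
      C * (Num.sqrt n%:R * (ln (n%:R : R)) ^+ 2)
        / Num.sqrt ((Mprof (msetOf a) * Mprof (msetOf b))%:R).
Proof.
have [z zE] : exists z : R, z = 16000^-1 by eexists.
pose D := 5 / z + 1.
pose t := 4 * (28 * D + 8 * D ^+ 2) ^+ 3 / (eps / 9) ^+ 9.
pose N := expR (Num.max 1 t).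
pose C1 := 2634 * Num.sqrt (56 * D).
pose C2 := N ^+ 4 / ln 2 ^+ 2.
exists (C1 + C2) => n a b n0 hM.
set M := (_ * _)%:R in hM *.
have nR : 0 < n%:R :> R by rewrite ltr0n.
have M0 : 0 < M by apply: lt_le_trans hM; exact: powR_gt0.
have n1 : (1 < n)%N.
  have : (0 < Mprof (msetOf a) * Mprof (msetOf b))%N by rewrite -(ltr0n R).
  by rewrite muln_gt0 => /andP[/Mprof_gt0_size].
set Y := _ * _ ^+ 2.
have Y0 : 0 <= Y by apply: mulr_ge0 (sqrtr_ge0 _) (sqr_ge0 _).
have C10 : 0 <= C1 by apply: mulr_ge0 (ler0n _ _) (sqrtr_ge0 _).
have C20 : 0 <= C2.
  by apply: divr_ge0 (sqr_ge0 _); apply: exprn_ge0; exact: expR_ge0.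
have mono (c : R) : c <= C1 + C2 -> c * Y / Num.sqrt M <= (C1 + C2) * Y / Num.sqrt M.
  move=> h; apply: ler_wpM2r; first by rewrite invr_ge0 sqrtr_ge0.
  exact: ler_wpM2r.
case: (lerP (Num.max 1 t) (ln n%:R)) => [|ht].
  rewrite ge_max => /andP[L1 ht].
  apply: le_trans (mono C1 _); last by rewrite lerDl.
  exact: (Qconc_le_large n1 heps zE erefl L1 ht hM).
apply: le_trans (mono C2 _); last by rewrite lerDr.
apply: Qconc_le_trivial => //.
by rewrite -[leLHS]lnK ?posrE // ler_expR ltW.
Qed.
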